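(* Let $n\ge4$ be an integer, and let $l,r$ be nonzero complex numbers such that $r^{2k}\ne1$ for $1\le k\le n$ and $r^{2k}\ne-1$ for $1\le k\le n-1$ (so that the Hecke algebras $\mathcal H(D_n)$ and $\mathcal H_{F,r^2}(n)$ are semisimple). (i) Suppose $n\neq5$. If there exists an irreducible $n$-dimensional invariant subspace inside $V_n$, then $l=-\frac1{r^{2n-5}}$. (ii) (Case $n=5$.) If there exists an irreducible $5$-dimensional invariant subspace inside $V_5$, then $l\in\{-\frac1{r^5},\,r^3\}$. If so, it is unique.
   Context: Put $m=\frac1r-r$ and $F=\mathbb Q(l,r)\subset\mathbb C$. $V_n$ is the $F$-vector space with basis $\{w_{ij},\widehat{w_{ij}}:1\le i<j\le n\}$. It carries endomorphisms $\nu_1,\dots,\nu_n$ defined as follows ($\overline{w_{s,t}}$ stands for either $w_{s,t}$ or $\widehat{w_{s,t}}$, same choice on both sides); they define a representation of the Cohen--Gijsbers--Wales algebra of type $D_n$. $\nu_1$: for $3\le i<j\le n$, $\nu_1(\widehat{w_{ij}})=m r^{j-5}(\widehat{w_{1,i}}-w_{1,i})+m r^{j-4}(\widehat{w_{2,i}}-w_{2,i})+m r^{i-3}(\widehat{w_{1,j}}-w_{1,j})+m r^{i-2}(\widehat{w_{2,j}}-w_{2,j})+m^2(r^{i+j-8}+r^{i+j-6})(\widehat{w_{12}}-w_{12})+r\,\widehat{w_{ij}}$; for $j\ge3$: $\nu_1(\widehat{w_{1j}})=w_{2j}$, $\nu_1(\widehat{w_{2j}})=w_{1j}+m r^{j-3}w_{12}-m\,w_{2j}$,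 $\nu_1(w_{2j})=\widehat{w_{1j}}+m r^{j-3}\widehat{w_{12}}-m\,w_{2j}$, $\nu_1(w_{1j})=\widehat{w_{2j}}+m r^{j-4}(\widehat{w_{12}}-w_{12})+m(\widehat{w_{1j}}-w_{1j})$; $\nu_1(\widehat{w_{12}})=\frac1l\widehat{w_{12}}$; $\nu_1(\overline{w_{s,t}})=r\,\overline{w_{s,t}}$ for all other basis vectors. $\nu_k$, $2\le k\le n$: $\nu_k(\overline{w_{k-1,t}})=\overline{w_{k,t}}$ for $t\ge k+1$; $\nu_k(\overline{w_{s,k-1}})=\overline{w_{s,k}}$ for $s\le k-2$; $\nu_k(\widehat{w_{k-1,k}})=r\,\widehat{w_{k-1,k}}$; $\nu_k(w_{k-1,k})=\frac1lw_{k-1,k}$; for $t\ge k+1$: $\nu_k(\widehat{w_{k,t}})=\widehat{w_{k-1,t}}+\frac ml r^{t-k-2}w_{k-1,k}-m\,\widehat{w_{k,t}}$ and $\nu_k(w_{k,t})=w_{k-1,t}+m r^{t-k-1}w_{k-1,k}-m\,w_{k,t}$; for $s\le k-2$: $\nu_k(\overline{w_{s,k}})=\overline{w_{s,k-1}}+\frac{m}{l\,r^{k-s-2}}w_{k-1,k}-m\,\overline{w_{s,k}}$; $\nu_k(\overline{w_{s,t}})=r\,\overline{w_{s,t}}$ for all other basis vectors. An invariant subspace of $V_n$ is an $F$-subspace stable under all $\nu_1,\dots,\nu_n$; it is irreducible if it is nonzero and has no invariant subspaces other than $0$ and itself. $\mathcal H(D_n)$ is the $F$-algebra with generators $g_1,\dots,g_n$,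 the Artin relations of type $D_n$ (node $1$ joined to node $3$, node $i$ joined to $i+1$ for $2\le i\le n-1$) and $g_i^2+mg_i=1$; $\mathcal H_{F,r^2}(n)$ is the Iwahori--Hecke algebra of $\mathrm{Sym}(n)$ with parameter $r^2$ over $F$. *)

(* Defs.v *)
From HB Require Import structures.
From mathcomp Require Import all_boot all_order all_algebra.
From mathcomp Require Import boolp reals.
From mathcomp Require Import complex.
Set Implicit Arguments.
Unset Strict Implicit.
Unset Printing Implicit Defensive.
Import GRing.Theory.
Local Open Scope ring_scope.

(* The subfield Q(l, r) of C: the intersection of all the subfields of C that
   contain l and r. *)
Definition adjoin2_pred (C : fieldType) (l r : C) : {pred C} :=
  fun x => `[< forall S : {pred C},
    divring_closed S -> l \in S -> r \in S -> x \in S >].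

Lemma adjoin2_divring_closed (C : fieldType) (l r : C) :
  divring_closed (adjoin2_pred l r).
Proof.
split.
- by apply/asboolP => S [].
- move=> x y /asboolP xS /asboolP yS; apply/asboolP => S clS lS rS.
  by case: (clS) => _ subS _; apply: subS; [apply: xS | apply: yS].
- move=> x y /asboolP xS /asboolP yS; apply/asboolP => S clS lS rS.
  by case: (clS) => _ _ divS; apply: divS; [apply: xS | apply: yS].
Qed.

HB.instance Definition _ (C : fieldType) (l r : C) :=
  GRing.isDivringClosed.Build C (adjoin2_pred l r)
    (adjoin2_divring_closed l r).

Record adjoin2 (C : fieldType) (l r : C) :=
  Adjoin2 { adjoin2_val : C; _ : adjoin2_val \in adjoin2_pred l r }.

HB.instance Definition _ (C : fieldType) (l r : C) :=
  [isSub for @adjoin2_val C l r].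
HB.instance Definition _ (C : fieldType) (l r : C) :=
  [Choice of adjoin2 l r by <:].
HB.instance Definition _ (C : fieldType) (l r : C) :=
  [SubChoice_isSubIntegralDomain of adjoin2 l r by <:].
HB.instance Definition _ (C : fieldType) (l r : C) :=
  [SubIntegralDomain_isSubField of adjoin2 l r by <:].

Lemma adjoin2_mem_l (C : fieldType) (l r : C) : l \in adjoin2_pred l r.
Proof. exact/asboolP. Qed.

Lemma adjoin2_mem_r (C : fieldType) (l r : C) : r \in adjoin2_pred l r.
Proof. exact/asboolP. Qed.

Definition adjoin2_l (C : fieldType) (l r : C) : adjoin2 l r :=
  Adjoin2 (adjoin2_mem_l l r).
Definition adjoin2_r (C : fieldType) (l r : C) : adjoin2 l r :=
  Adjoin2 (adjoin2_mem_r l r).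

(* Pairs 1 <= i < j <= n; the indices are 1-based, hence 'I_n.+1. *)
Definition pairs (n : nat) :=
  {p : 'I_n.+1 * 'I_n.+1 | (0 < p.1)%N && (p.1 < p.2)%N}.

Section Representation.

Variables (F : fieldType) (l r : F) (n : nat).

Let m : F := r^-1 - r.

(* The boolean component of an index is true for the hatted vectors. *)
Definition Vn := {ffun pairs n * bool -> F^o}.

(* w false i j is w_ij and w true i j is its hatted version; both are the null
   vector unless 1 <= i < j <= n. *)
Definition w (h : bool) (i j : nat) : Vn :=
  [ffun b : pairs n * bool =>
     [&& val (val b.1).1 == i, val (val b.1).2 == j & b.2 == h]%:R].

(* The images of w h i j, for i < j, under nu_1 and, for 2 <= k, under nu_k.
   The exponents are integers, as some of them are negative. *)
Definition nu1_basis (h : bool) (i j : nat) : Vn :=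
  if i == 1%N then
    if j == 2%N then
      if h then l^-1 *: w true 1 2 else r *: w false 1 2
    else
      if h then w false 2 j
      else w true 2 j
           + (m * r ^ (j%:Z - 4)) *: (w true 1 2 - w false 1 2)
           + m *: (w true 1 j - w false 1 j)
  else if i == 2%N then
    if h then w false 1 j + (m * r ^ (j%:Z - 3)) *: w false 1 2
              - m *: w false 2 j
    else w true 1 j + (m * r ^ (j%:Z - 3)) *: w true 1 2
         - m *: w false 2 j
  else
    if h then
      (m * r ^ (j%:Z - 5)) *: (w true 1 i - w false 1 i)
      + (m * r ^ (j%:Z - 4)) *: (w true 2 i - w false 2 i)
      + (m * r ^ (i%:Z - 3)) *: (w true 1 j - w false 1 j)
      + (m * r ^ (i%:Z - 2)) *: (w true 2 j - w false 2 j)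
      + (m ^+ 2 * (r ^ (i%:Z + j%:Z - 8) + r ^ (i%:Z + j%:Z - 6)))
          *: (w true 1 2 - w false 1 2)
      + r *: w true i j
    else r *: w false i j.

Definition nuk_basis (k : nat) (h : bool) (i j : nat) : Vn :=
  if (i == k.-1) && (j == k) then
    if h then r *: w true k.-1 k else l^-1 *: w false k.-1 k
  else if i == k.-1 then w h k j
  else if j == k.-1 then w h i k
  else if i == k then
    if h then
      w true k.-1 j + (m / l * r ^ (j%:Z - k%:Z - 2)) *: w false k.-1 k
      - m *: w true k j
    else
      w false k.-1 j + (m * r ^ (j%:Z - k%:Z - 1)) *: w false k.-1 k
      - m *: w false k j
  else if j == k then
    w h i k.-1 + (m / (l * r ^ (k%:Z - i%:Z - 2))) *: w false k.-1 k
    - m *: w h i k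
  else r *: w h i j.

Definition nu_basis (k : nat) (b : pairs n * bool) : Vn :=
  let i := val (val b.1).1 in
  let j := val (val b.1).2 in
  if k == 1%N then nu1_basis b.2 i j else nuk_basis k b.2 i j.

Definition nu (k : nat) (v : Vn) : Vn := \sum_b v b *: nu_basis k b.

Lemma nu_is_linear k : linear (nu k).
Proof.
move=> a u v; rewrite /nu scaler_sumr -big_split /=; apply: eq_bigr => b _.
by rewrite !ffunE scalerDl scalerA.
Qed.

HB.instance Definition _ k :=
  GRing.isLinear.Build F Vn Vn *:%R (nu k) (nu_is_linear k).

Definition invariant_subspace (W : {vspace Vn}) : Prop :=
  forall k : nat, (1 <= k <= n)%N -> forall v : Vn, v \in W -> nu k v \in W.

Definition irreducible_invariant (W : {vspace Vn}) : Prop :=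
  [/\ invariant_subspace W,
      W <> 0%VS
    & forall U : {vspace Vn}, invariant_subspace U -> (U <= W)%VS ->
        U = 0%VS \/ U = W].

End Representation.

(* Main.v *)
(** Put E_k = nu_k - r. An invariant subspace W of dimension n contains no
    w_{k-1,k} and not hat w_{12}, so that E_k^2 = -(r + 1/r) E_k on W. A vector
    y of E_n W is determined by its coordinates at the w_{s,n} and hat w_{s,n}
    with s <= n - 2, and E_n E_{n-1} y - y has no such coordinate except
    possibly at w_{n-2,n}; if that one were nonzero, applying the nu_j with
    j <= n - 2 would give dim E_n W >= 2(n - 2), which is too large. By
    conjugation E_i E_j E_i = E_i on W for all adjacent nodes i and j, that is,
    W is a Temperley-Lieb module of type D_n; in particular
    2 dim E_n W <= n, and the inequality is strict for n >= 5.

    If every E_j with j <= n - 2 kills E_n W, then E_n W is a line, and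
    computing the coordinate at w_{n-1,n} of its generator in two ways (from
    E_n E_{n-1} y = y, and from E_1 E_2 ... E_{n-1} y = 0) gives
    l = -1/r^(2n-5). Otherwise there is a nonzero u in E_n W with
    nu_2 u = -u/r, which may be chosen to be an eigenvector of nu_1. For n >= 6
    its images under nu_3, ..., nu_{n-2} give dim E_n W >= n - 3, which is too
    large; for n = 4 it generates a submodule of dimension at most 3; for n = 5
    either E_1 u = 0 and u, E_3 u, E_1 E_3 u are independent in E_n W, which is
    too large again, or nu_1 u = -u/r and l = r^3. In the surviving cases W
    contains a vector that depends only on l and r, hence the uniqueness. *)
From HB Require Import structures.
Require Import Defs.
From mathcomp Require Import all_boot all_order all_algebra.
From mathcomp Require Import boolp reals.
From mathcomp Require Import complex.
From mathcomp Require Import zify ring.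
Set Implicit Arguments.
Unset Strict Implicit.
Unset Printing Implicit Defensive.
Import GRing.Theory.
Local Open Scope ring_scope.

(** * Relations between the images of the basis vectors *)

(* The space is kept abstract because unification on Vn unfolds w and nu. *)
Section Rel.
Variables (F : fieldType) (l r : F) (n : nat) (V : lmodType F) (B : Type).
Variables (w : bool -> nat -> nat -> V) (c : B -> V -> F) (nu : nat -> V -> V).

Let m : F := r^-1 - r.

(** Indexing the generator as nu_(a+1) and writing integer powers of r as quotients of natural
    powers removes every truncated subtraction and lets [field] settle the identities below. *)
Definition nuS_image (a : nat) (h : bool) (i j : nat) : V :=
  if (i == a) && (j == a.+1) then
    if h then r *: w true a a.+1 else l^-1 *: w false a a.+1
  else if i == a then w h a.+1 j
  else if j == a then w h i a.+1
  else if i == a.+1 then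
    if h then
      w true a j + (m / l * (r ^+ j / (r ^+ 3 * r ^+ a))) *: w false a a.+1
      - m *: w true a.+1 j
    else
      w false a j + (m * (r ^+ j / (r ^+ 2 * r ^+ a))) *: w false a a.+1
      - m *: w false a.+1 j
  else if j == a.+1 then
    w h i a + (m / l * (r * r ^+ i / r ^+ a)) *: w false a a.+1
    - m *: w h i a.+1
  else r *: w h i j.

Definition nu1_image (h : bool) (i j : nat) : V :=
  if i == 1%N then
    if j == 2%N then
      if h then l^-1 *: w true 1 2 else r *: w false 1 2
    else
      if h then w false 2 j
      else w true 2 j
           + (m * (r ^+ j / r ^+ 4)) *: (w true 1 2 - w false 1 2)
           + m *: (w true 1 j - w false 1 j)
  else if i == 2%N then
    if h then w false 1 j + (m * (r ^+ j / r ^+ 3)) *: w false 1 2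
              - m *: w false 2 j
    else w true 1 j + (m * (r ^+ j / r ^+ 3)) *: w true 1 2
         - m *: w false 2 j
  else
    if h then
      (m * (r ^+ j / r ^+ 5)) *: (w true 1 i - w false 1 i)
      + (m * (r ^+ j / r ^+ 4)) *: (w true 2 i - w false 2 i)
      + (m * (r ^+ i / r ^+ 3)) *: (w true 1 j - w false 1 j)
      + (m * (r ^+ i / r ^+ 2)) *: (w true 2 j - w false 2 j)
      + (m ^+ 2 * (r ^+ i * r ^+ j / r ^+ 8 + r ^+ i * r ^+ j / r ^+ 6))
          *: (w true 1 2 - w false 1 2)
      + r *: w true i j
    else r *: w false i j.

Hypotheses (l0 : l != 0) (r0 : r != 0).
Hypothesis cD : forall b u v, c b (u + v) = c b u + c b v.
Hypothesis cN : forall b v, c b (- v) = - c b v.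
Hypothesis cZ : forall b a v, c b (a *: v) = a * c b v.
Hypothesis c_inj : forall u v, (forall b, c b u = c b v) -> u = v.
Hypothesis nuD : forall k u v, nu k (u + v) = nu k u + nu k v.
Hypothesis nuN : forall k v, nu k (- v) = - nu k v.
Hypothesis nuZ : forall k a v, nu k (a *: v) = a *: nu k v.
Hypothesis nuS_w : forall a h i j, (0 < a)%N -> (0 < i < j)%N -> (j <= n)%N ->
  nu a.+1 (w h i j) = nuS_image a h i j.
Hypothesis nu1_w : forall h i j, (0 < i < j)%N -> (j <= n)%N ->
  nu 1 (w h i j) = nu1_image h i j.

Let eqnSx k : (k.+1 == k) = false. Proof. by lia. Qed.
Let eqnxS k : (k == k.+1) = false. Proof. by lia. Qed.
Let eqnSSx k : (k.+2 == k) = false. Proof. by lia. Qed.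
Let eqnxSS k : (k == k.+2) = false. Proof. by lia. Qed.
Let eqnE := (eqnSx, eqnxS, eqnSSx, eqnxSS, eqxx, eqSS).

Ltac use_eqs :=
  rewrite ?eqnE /=;
  repeat (match goal with
    | H : (?x == ?y) = false |- context [?x == ?y] => rewrite H
  end; rewrite /=).

Ltac nu_side := first [assumption | lia].
Ltac expand_nu :=
  repeat (match goal with
  | |- context [nu ?k (w ?h ?i ?j)] =>
      let H := fresh "H" in
      eassert (nu k (w h i j) = _) as H;
      [ first [rewrite nu1_w; [|nu_side..]; rewrite /nu1_image
              | rewrite nuS_w; [|nu_side..]; rewrite /nuS_image];
        use_eqs; reflexivity
      | rewrite !H; clear H; rewrite ?(nuD, nuN, nuZ)]
  end).

Ltac coord :=
  rewrite ?exprS ?expr0;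
  let b := fresh "b" in
  apply: c_inj => b;
  rewrite ?(cD, cN, cZ);
  repeat match goal with |- context [c b ?v] =>
    move: (c b v) => ? end.


Let Fr k : r ^+ k != 0. Proof. by rewrite expf_neq0. Qed.

Ltac split_eq x y :=
  let e := fresh "e" in
  have [e|/negbTE e] := eqVneq x y;
  [first [exfalso; lia | try subst x] | try (exfalso; lia)].

Ltac solve_field := rewrite /m; field; rewrite ?Fr ?l0 ?r0.

(** The indices i and j matter only through their coincidences with a, a+1 and a+2; in each case
    both sides are explicit and agree by a rational identity in l and r. The other Artin relations
    are verified in the same way. *)
Lemma braidS_w a h i j : (0 < a)%N -> (a.+2 <= n)%N -> (0 < i < j)%N -> (j <= n)%N ->
  nu a.+1 (nu a.+2 (nu a.+1 (w h i j))) = nu a.+2 (nu a.+1 (nu a.+2 (w h i j))).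
Proof.
move=> a0 an ij jn.
have a0' : (a == 0)%N = false by lia.
split_eq i a; last split_eq i a.+1; last split_eq i a.+2;
(split_eq j a; last split_eq j a.+1; last split_eq j a.+2).
all: case: h; expand_nu.
all: coord.
all: by solve_field.
Qed.

Lemma commSS_w a b h i j : (0 < a)%N -> (a.+1 < b)%N -> (b < n)%N -> (0 < i < j)%N -> (j <= n)%N ->
  nu a.+1 (nu b.+1 (w h i j)) = nu b.+1 (nu a.+1 (w h i j)).
Proof.
move=> a0 ab bn ij jn.
have h1 : (a == 0)%N = false by lia.
have h2 : (b == 0)%N = false by lia.
have h3 : (b == a)%N = false by lia.
have h4 : (a == b)%N = false by lia.
have h5 : (b == a.+1)%N = false by lia.
have h6 : (a.+1 == b)%N = false by lia.
have h7 : (a == b.+1)%N = false by lia.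
have h8 : (b.+1 == a)%N = false by lia.
split_eq i a; last split_eq i a.+1; last split_eq i b; last split_eq i b.+1;
(split_eq j a; last split_eq j a.+1; last split_eq j b; last split_eq j b.+1).
all: case: h; expand_nu.
all: coord.
all: (by solve_field).
Qed.

Lemma comm12_w h i j : (1 < n)%N -> (0 < i < j)%N -> (j <= n)%N ->
  nu 1 (nu 2 (w h i j)) = nu 2 (nu 1 (w h i j)).
Proof.
move=> n1 ij jn.
split_eq i 1%N; last split_eq i 2%N;
(split_eq j 1%N; last split_eq j 2%N).
all: case: h; expand_nu.
all: coord.
all: (by solve_field).
Qed.

Lemma comm1S_w b h i j : (2 < b < n)%N -> (0 < i < j)%N -> (j <= n)%N ->
  nu 1 (nu b.+1 (w h i j)) = nu b.+1 (nu 1 (w h i j)).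
Proof.
move=> bn ij jn.
have h1 : (b == 0)%N = false by lia.
have h2 : (b == 1)%N = false by lia.
have h3 : (b == 2)%N = false by lia.
have h4 : (0 == b)%N = false by lia.
have h5 : (1 == b)%N = false by lia.
have h6 : (2 == b)%N = false by lia.
split_eq i 1%N; last split_eq i 2%N; last split_eq i b; last split_eq i b.+1;
(split_eq j 1%N; last split_eq j 2%N; last split_eq j b; last split_eq j b.+1).
all: case: h; expand_nu.
all: coord.
all: (by solve_field).
Qed.

Lemma braid13_w h i j : (2 < n)%N -> (0 < i < j)%N -> (j <= n)%N ->
  nu 1 (nu 3 (nu 1 (w h i j))) = nu 3 (nu 1 (nu 3 (w h i j))).
Proof.
move=> n2 ij jn.
split_eq i 1%N; last split_eq i 2%N; last split_eq i 3%N;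
(split_eq j 1%N; last split_eq j 2%N; last split_eq j 3%N).
all: case: h; expand_nu.
all: coord.
all: (by solve_field).
Qed.

(** The quadratic Hecke relation fails only along w_(a,a+1), the one vector along which nu_(a+1) has
    correction terms. *)
Lemma quadS_w a h i j : (0 < a)%N -> (a < n)%N -> (0 < i < j)%N -> (j <= n)%N ->
  exists x, nu a.+1 (nu a.+1 (w h i j)) + m *: nu a.+1 (w h i j) - w h i j
    = x *: w false a a.+1.
Proof.
move=> a0 an ij jn.
have a0' : (a == 0)%N = false by lia.
pose q := if h then m / l * (r ^+ j / (r ^+ 3 * r ^+ a)) else m * (r ^+ j / (r ^+ 2 * r ^+ a)).
pose q' := m / l * (r * r ^+ i / r ^+ a).
(* The defect is the correction [q] or [q'], divided by l when it already appears in the first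
   application of nu_(a+1). Vectors scaled by r have none, since r^2 + m r = 1. *)
exists (if (i == a) && (j == a.+1) then if h then 0 else l^-1 * l^-1 + m * l^-1 - 1
        else if i == a then q else if j == a then q' else if i == a.+1 then q / l
        else if j == a.+1 then q' / l else 0).
rewrite /q /q' => {q q'}.
split_eq i a; last split_eq i a.+1;
(split_eq j a; last split_eq j a.+1); use_eqs.
all: case: h; expand_nu.
all: coord.
all: (by solve_field).
Qed.

Lemma quad1_w h i j : (1 < n)%N -> (0 < i < j)%N -> (j <= n)%N ->
  exists x, nu 1 (nu 1 (w h i j)) + m *: nu 1 (w h i j) - w h i j
    = x *: w true 1 2.
Proof.
move=> n1 ij jn.
exists (if i == 1%N then if j == 2%N then if h then l^-1 * l^-1 + m * l^-1 - 1 else 0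
          else if h then m * (r ^+ j / r ^+ 3) else m / l * (r ^+ j / r ^+ 4)
        else if i == 2%N then if h then m * (r ^+ j / r ^+ 2) else m / l * (r ^+ j / r ^+ 3)
        else if h then m ^+ 2 * (r ^+ i * r ^+ j / r ^+ 8) * (1 + r ^+ 2) * (l^-1 - r) else 0).
split_eq i 1%N; last split_eq i 2%N;
(split_eq j 1%N; last split_eq j 2%N); use_eqs.
all: case: h; expand_nu.
all: coord.
all: (by solve_field).
Qed.
End Rel.

(** * Coordinates of the images *)

Section Coord.
Variables (F : fieldType) (l r : F) (n : nat) (V : lmodType F).
Variables (w : bool -> nat -> nat -> V) (co : bool -> nat -> nat -> V -> F) (nu : nat -> V -> V).

Let m : F := r^-1 - r.

Hypotheses (l0 : l != 0) (r0 : r != 0).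
Hypothesis coD : forall h i j u v, co h i j (u + v) = co h i j u + co h i j v.
Hypothesis coN : forall h i j v, co h i j (- v) = - co h i j v.
Hypothesis coZ : forall h i j a v, co h i j (a *: v) = a * co h i j v.
Hypothesis co_w : forall h i j h' i' j', (0 < i' < j')%N -> (j' <= n)%N ->
  co h i j (w h' i' j') = [&& i' == i, j' == j & h' == h]%:R.
Hypothesis w_ind : forall P : V -> Prop,
  (forall a u v, P u -> P v -> P (a *: u + v)) -> P 0 ->
  (forall h i j, (0 < i < j)%N -> (j <= n)%N -> P (w h i j)) -> forall v, P v.
Hypothesis nuP : forall k a u v, nu k (a *: u + v) = a *: nu k u + nu k v.
Hypothesis nuS_w : forall a h i j, (0 < a)%N -> (0 < i < j)%N -> (j <= n)%N ->
  nu a.+1 (w h i j) = nuS_image l r w a h i j.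
Hypothesis nu1_w : forall h i j, (0 < i < j)%N -> (j <= n)%N ->
  nu 1 (w h i j) = nu1_image l r w h i j.

Definition scal (f : V -> F) := forall a u v, f (a *: u + v) = a * f u + f v.

Let scal_ext (f g : V -> F) : scal f -> scal g ->
  (forall h i j, (0 < i < j)%N -> (j <= n)%N -> f (w h i j) = g (w h i j)) ->
  forall v, f v = g v.
Proof.
move=> fP gP fg; apply: w_ind => // [a u v eu ev|]; first by rewrite fP gP eu ev.
have e0 (h : V -> F) : scal h -> h 0 = 0.
  by move=> hP; move: (hP (-1) 0 0); rewrite scaler0 addr0 mulN1r addNr.
by rewrite !e0.
Qed.

Let scal_nu h i j k : scal (fun v => co h i j (nu k v)).
Proof. by move=> a u v; rewrite nuP coD coZ. Qed.
Let scal_co h i j c : scal (fun v => c * co h i j v).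
Proof. by move=> a u v; rewrite coD coZ; ring. Qed.
Let scal_co1 h i j : scal (fun v => co h i j v).
Proof. by move=> a u v; rewrite coD coZ. Qed.
Let scal_D f g : scal f -> scal g -> scal (fun v => f v + g v).
Proof. by move=> fP gP a u v; rewrite fP gP; ring. Qed.
Let scal_B f g : scal f -> scal g -> scal (fun v => f v - g v).
Proof. by move=> fP gP a u v; rewrite fP gP; ring. Qed.
Let scal_sum p q (f : nat -> V -> F) : (forall t, scal (f t)) ->
  scal (fun v => \sum_(p <= t < q) f t v).
Proof.
move=> fP a u v; rewrite mulr_sumr -big_split; apply: eq_bigr => t _.
exact: fP.
Qed.

Ltac decide_eqs :=
  repeat (rewrite ?eqxx /=; match goal with
    | |- context [@eq_op ?T ?x ?y] => 
        first [ rewrite (_ : (@eq_op T x y) = false); [|by lia]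
              | rewrite (_ : (@eq_op T x y) = true); [|by lia]
              | case: (@eqVneq T x y) => ? ]
    end); rewrite ?eqxx /=.
Ltac co_case :=
  first [rewrite nu1_w; [|lia..]; rewrite /nu1_image
        |rewrite nuS_w; [|lia..]; rewrite /nuS_image];
  decide_eqs;
  rewrite ?(coD, coN, coZ) ?co_w; try lia.

(** This lemma and the next ones each read off rows of the matrix of some nu_k, so that later
    arguments never expand a vector in the basis. *)
Lemma co_nu_other (a : nat) h (i j : nat) v : (0 < a)%N -> (a < n)%N ->
  (i != a)%N -> (i != a.+1)%N -> (j != a)%N -> (j != a.+1)%N ->
  co h i j (nu a.+1 v) = r * co h i j v.
Proof.
move=> a0 an ia ia1 ja ja1; move: v; apply: scal_ext => // h' i' j' ij' jn'.
case: h; case: h'; co_case; decide_eqs; try ring.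
Qed.

Lemma co_nu_self a v : (0 < a)%N -> (a < n)%N ->
  co true a a.+1 (nu a.+1 v) = r * co true a a.+1 v.
Proof.
move=> a0 an; move: v; apply: scal_ext => // h' i' j' ij' jn'.
case: h'; co_case; decide_eqs; try ring.
Qed.

Lemma co_nu_l (a : nat) h (s : nat) v : (0 < a)%N -> (a < n)%N -> (0 < s < a)%N ->
  co h s a (nu a.+1 v) = co h s a.+1 v.
Proof.
move=> a0 an sa; move: v; apply: scal_ext => // h' i' j' ij' jn'.
case: h; case: h'; co_case; decide_eqs; try ring.
Qed.

Lemma co_nu_lS (a : nat) h (s : nat) v : (0 < a)%N -> (a < n)%N -> (0 < s < a)%N ->
  co h s a.+1 (nu a.+1 v) = co h s a v - m * co h s a.+1 v.
Proof.
move=> a0 an sa; move: v; apply: scal_ext => //; first exact: scal_B.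
move=> h' i' j' ij' jn'.
case: h; case: h'; co_case; decide_eqs; rewrite /m; try ring.
Qed.

Lemma co_nu_r a h t v : (0 < a)%N -> (a < n)%N -> (a.+1 < t <= n)%N ->
  co h a t (nu a.+1 v) = co h a.+1 t v.
Proof.
move=> a0 an ta; move: v; apply: scal_ext => // h' i' j' ij' jn'.
case: h; case: h'; co_case; decide_eqs; try ring.
Qed.

Lemma co_nu_rS a h t v : (0 < a)%N -> (a < n)%N -> (a.+1 < t <= n)%N ->
  co h a.+1 t (nu a.+1 v) = co h a t v - m * co h a.+1 t v.
Proof.
move=> a0 an ta; move: v; apply: scal_ext => //; first exact: scal_B.
move=> h' i' j' ij' jn'.
case: h; case: h'; co_case; decide_eqs; rewrite /m; try ring.
Qed.

Let sum_delta2 p q (f : nat -> F) (A C : bool) x :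
  \sum_(p <= t < q) f t * [&& A, x == t & C]%:R = [&& A, (p <= x < q)%N & C]%:R * f x.
Proof.
case: A => /=; last by rewrite mul0r big1 // => t _; rewrite mulr0.
case: C; last by rewrite andbF mul0r big1 // => t _; rewrite andbF mulr0.
rewrite andbT; case: (boolP (p <= x < q)%N) => [xpq|xpq].
  rewrite (bigD1_seq x) /= ?mem_index_iota ?iota_uniq // eqxx mulr1 mul1r big1 ?addr0 //.
  by move=> t /negbTE tx; rewrite eq_sym tx mulr0.
rewrite mul0r big_nat big1 // => t tpq.
by case: eqP => [xt|_]; rewrite ?mulr0 //; rewrite xt tpq in xpq.
Qed.

Let sum_delta1 p q (f : nat -> F) (A C : bool) x :
  \sum_(p <= t < q) f t * [&& x == t, A & C]%:R = [&& A, (p <= x < q)%N & C]%:R * f x.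
Proof.
rewrite -sum_delta2; apply: eq_bigr => t _; congr (_ * _%:R).
by case: A; rewrite //= andbF.
Qed.

(** Only vectors with an index a+1 can contribute to this row, because the corrections along
    w_(a,a+1) occur in their images alone. This is the row through which l enters. *)
Lemma co_nu_N a v : (0 < a)%N -> (a < n)%N ->
  co false a a.+1 (nu a.+1 v) = l^-1 * co false a a.+1 v
   + \sum_(a.+2 <= t < n.+1) m * (r ^+ t / (r ^+ 2 * r ^+ a)) * co false a.+1 t v
   + \sum_(a.+2 <= t < n.+1) m / l * (r ^+ t / (r ^+ 3 * r ^+ a)) * co true a.+1 t v
   + \sum_(1 <= s < a) m / l * (r * r ^+ s / r ^+ a) * co false s a.+1 v
   + \sum_(1 <= s < a) m / l * (r * r ^+ s / r ^+ a) * co true s a.+1 v.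
Proof.
move=> a0 an; move: v; apply: scal_ext => //.
  by do !apply: scal_D => //; apply: scal_sum.
move=> h' i' j' ij' jn'.
have E h p q (f : nat -> F) : \sum_(p <= t < q) f t * co h a.+1 t (w h' i' j') =
    [&& i' == a.+1, (p <= j' < q)%N & h' == h]%:R * f j'.
  by rewrite -sum_delta2; apply: eq_bigr => t _; rewrite co_w.
have E' h p q (f : nat -> F) : \sum_(p <= t < q) f t * co h t a.+1 (w h' i' j') =
    [&& j' == a.+1, (p <= i' < q)%N & h' == h]%:R * f i'.
  by rewrite -sum_delta1; apply: eq_bigr => t _; rewrite co_w.
rewrite !E !E' {E E'} co_w //.
have [jp|jp] := boolP (a.+2 <= j' < n.+1)%N; have [ip|ip] := boolP (0 < i' < a)%N;
case: h'; co_case; decide_eqs; rewrite -/m; try ring; try lia.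
Qed.

(** Of nu_1 only rows with second index n are computed: they hold the coordinates that determine a
    vector of E_n W. *)
Lemma co_nu1_2 v : (2 < n)%N ->
  co true 2 n (nu 1 v) = co false 1 n v
    + \sum_(3 <= i < n) m * (r ^+ i / r ^+ 2) * co true i n v.
Proof.
move=> n2; move: v; apply: scal_ext => //.
  by do !apply: scal_D => //; apply: scal_sum.
move=> h' i' j' ij' jn'.
have E h p q (f : nat -> F) : \sum_(p <= t < q) f t * co h t n (w h' i' j') =
    [&& j' == n, (p <= i' < q)%N & h' == h]%:R * f i'.
  by rewrite -sum_delta1; apply: eq_bigr => t _; rewrite co_w.
rewrite !E {E} co_w //.
have [ip|ip] := boolP (2 < i' < n)%N;
case: h'; co_case; decide_eqs; rewrite -/m; try ring; try lia.
Qed.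

Lemma co_nu1_1 v : (2 < n)%N ->
  co true 1 n (nu 1 v) = co false 2 n v + m * co false 1 n v
    + \sum_(3 <= i < n) m * (r ^+ i / r ^+ 3) * co true i n v.
Proof.
move=> n2; move: v; apply: scal_ext => //.
  by do !apply: scal_D => //; apply: scal_sum.
move=> h' i' j' ij' jn'.
have E h p q (f : nat -> F) : \sum_(p <= t < q) f t * co h t n (w h' i' j') =
    [&& j' == n, (p <= i' < q)%N & h' == h]%:R * f i'.
  by rewrite -sum_delta1; apply: eq_bigr => t _; rewrite co_w.
rewrite !E {E} !co_w //.
have [ip|ip] := boolP (2 < i' < n)%N;
case: h'; co_case; decide_eqs; rewrite -/m; try ring; try lia.
Qed.

Lemma co_nu1_s s v : (2 < s < n)%N -> co true s n (nu 1 v) = r * co true s n v.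
Proof.
move=> sn; move: v; apply: scal_ext => // h' i' j' ij' jn'.
case: h'; co_case; decide_eqs; try ring; try lia.
Qed.
End Coord.

(** * Coordinates on the basis of V_n *)

Section Coordinates.
Variables (F : fieldType) (n : nat).
Local Notation V := (Vn F n).
Local Notation w := (@w F n).

Let vD (b : pairs n * bool) (u v : V) : (u + v) b = u b + v b.
Proof. by rewrite ffunE. Qed.
Let vN (b : pairs n * bool) (v : V) : (- v) b = - v b.
Proof. by rewrite ffunE. Qed.
Let vZ (b : pairs n * bool) (a : F) (v : V) : (a *: v) b = a * v b.
Proof. by rewrite ffunE. Qed.
Let v_inj (u v : V) : (forall b, u b = v b) -> u = v.
Proof. by move=> h; apply/ffunP. Qed.

Lemma pair_eqP (p : pairs n) (i j : nat) (q : pairs n) :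
  val (val p).1 = i -> val (val p).2 = j -> val (val q).1 = i ->
  val (val q).2 = j -> p = q.
Proof.
case: p q => [[p1 p2] hp] [[q1 q2] hq] /= e1 e2 e3 e4.
by apply/val_inj; congr pair; apply/val_inj; rewrite /= ?e1 ?e2.
Qed.

Lemma pair_ex (i j : nat) : (0 < i < j)%N -> (j <= n)%N ->
  {p : pairs n | val (val p).1 = i & val (val p).2 = j}.
Proof.
move=> /andP[i0 ij] jn.
have hi : (i < n.+1)%N by lia.
have hj : (j < n.+1)%N by lia.
pose p := (Ordinal hi, Ordinal hj).
have hp : (0 < p.1)%N && (p.1 < p.2)%N by rewrite /= i0.
by exists (exist _ p hp).
Qed.

Lemma w_sum (v : V) : v = \sum_b v b *: w b.2 (val (val b.1).1) (val (val b.1).2).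
Proof.
apply/ffunP => b; rewrite sum_ffunE (bigD1 b) //= !ffunE !eqxx /= big1 ?addr0.
  by rewrite /GRing.scale /= mulr1.
move=> [q h'] qh; rewrite !ffunE /=.
case: andP; last by rewrite scaler0.
move=> [/eqP qi /andP[/eqP qj /eqP hh]]; case/negP: qh.
by rewrite -hh; case: b qi qj hh => b h /= qi qj _; rewrite (pair_eqP (erefl _) (erefl _) qi qj).
Qed.

Lemma w_ind (P : V -> Prop) :
  (forall a u v, P u -> P v -> P (a *: u + v)) -> P 0 ->
  (forall h i j, (0 < i < j)%N -> (j <= n)%N -> P (w h i j)) -> forall v, P v.
Proof.
move=> PD P0 Pw v; rewrite (w_sum v).
apply: (big_ind P) => // [x y px py|[[[p1 p2] hp] h] _ /=].
  by rewrite -[x]scale1r; apply: PD.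
by rewrite -[_ *: _]addr0; apply: PD => //; apply: Pw => //; rewrite -ltnS.
Qed.

(* The coordinate of v at w h i j; null unless 1 <= i < j <= n. *)
Definition co (h : bool) (i j : nat) (v : V) : F :=
  \sum_(b : pairs n * bool |
     [&& val (val b.1).1 == i, val (val b.1).2 == j & b.2 == h]) v b.

Lemma coP h i j c u v : co h i j (c *: u + v) = c * co h i j u + co h i j v.
Proof. by rewrite /co mulr_sumr -big_split; apply: eq_bigr => b _; rewrite vD vZ. Qed.
Lemma co0 h i j : co h i j 0 = 0.
Proof. by rewrite /co big1 // => b _; rewrite ffunE. Qed.
Lemma coD h i j u v : co h i j (u + v) = co h i j u + co h i j v.
Proof. by rewrite -[u]scale1r coP scale1r mul1r. Qed.
Lemma coZ h i j c u : co h i j (c *: u) = c * co h i j u.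
Proof. by rewrite -[c *: u]addr0 coP co0 addr0. Qed.
Lemma coN h i j u : co h i j (- u) = - co h i j u.
Proof. by rewrite -scaleN1r coZ mulN1r. Qed.

Lemma coE h i j (p : pairs n) v :
  val (val p).1 = i -> val (val p).2 = j -> co h i j v = v (p, h).
Proof.
move=> pi pj; rewrite /co (big_pred1 (p, h)) // => -[q h'] /=.
apply/idP/eqP => [/and3P[/eqP qi /eqP qj /eqP ->]|[-> ->]].
  by rewrite (pair_eqP qi qj pi pj).
by rewrite pi pj !eqxx.
Qed.

Lemma co_inj u v : (forall h i j, (0 < i < j)%N -> (j <= n)%N ->
  co h i j u = co h i j v) -> u = v.
Proof.
move=> uv; apply/ffunP => -[p h].
have := uv h _ _ (valP p); rewrite -ltnS ltn_ord => /(_ isT).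
by rewrite !(coE _ _ (erefl (val (val p).1)) (erefl (val (val p).2))).
Qed.

Lemma co_w h i j h' i' j' : (0 < i' < j')%N -> (j' <= n)%N ->
  co h i j (w h' i' j') = [&& i' == i, j' == j & h' == h]%:R.
Proof.
move=> ij jn; have [p pi pj] := pair_ex ij jn.
rewrite /co (bigID (pred1 (p, h'))) /= [X in _ + X]big1 ?addr0; last first.
  move=> [q g] /andP[_ qp]; rewrite ffunE /=.
  case: and3P => // -[/eqP qi /eqP qj /eqP gh]; case/eqP: qp.
  by rewrite (pair_eqP qi qj pi pj) gh.
case e: [&& i' == i, j' == j & h' == h].
  case/and3P: e => /eqP ei /eqP ej /eqP eh.
  rewrite (big_pred1 (p, h')) ?ffunE /= ?pi ?pj ?eqxx // => -[q g] /=.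
  apply/andP/eqP => [[_ /eqP ->//]|[-> ->]].
  by rewrite pi pj ei ej eh !eqxx.
rewrite big_pred0 // => -[q g] /=; apply/negP => /andP[] /[swap] /eqP[-> ->].
by rewrite pi pj e.
Qed.

End Coordinates.

(** * Artin relations, quadratic defects and matrix rows for the operators on V_n *)

Section Rep.
Variables (F : fieldType) (l r : F) (n : nat).
Hypotheses (l0 : l != 0) (r0 : r != 0).
Let m : F := r^-1 - r.
Local Notation V := (Vn F n).
Local Notation nu := (@nu F l r n).
Local Notation w := (@w F n).


Let vD (b : pairs n * bool) (u v : V) : (u + v) b = u b + v b.
Proof. by rewrite ffunE. Qed.
Let vN (b : pairs n * bool) (v : V) : (- v) b = - v b.
Proof. by rewrite ffunE. Qed.
Let vZ (b : pairs n * bool) (a : F) (v : V) : (a *: v) b = a * v b.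
Proof. by rewrite ffunE. Qed.
Let v_inj (u v : V) : (forall b, u b = v b) -> u = v.
Proof. by move=> h; apply/ffunP. Qed.

Lemma expz_natB (i j : nat) : r ^ (i%:Z - j%:Z) = r ^+ i / r ^+ j.
Proof. by rewrite expfzDr // -exprnN. Qed.

Lemma nu_w k h i j : (0 < i < j)%N -> (j <= n)%N ->
  nu k (w h i j) = if k == 1%N then nu1_basis l r n h i j else nuk_basis l r n k h i j.
Proof.
move=> ij jn; have [p pi pj] := pair_ex ij jn.
rewrite /Defs.nu (bigD1 (p, h)) //= ffunE pi pj !eqxx scale1r big1 ?addr0.
  by rewrite /nu_basis /= pi pj.
move=> [q h'] qh; rewrite ffunE /=.
case: andP; last by rewrite scale0r.
move=> [/eqP qi /andP[/eqP qj /eqP hh]]; case/negP: qh.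
by rewrite hh (pair_eqP qi qj pi pj).
Qed.

Lemma nuS_w a h i j : (0 < a)%N -> (0 < i < j)%N -> (j <= n)%N ->
  nu a.+1 (w h i j) = nuS_image l r w a h i j.
Proof.
move=> a0 ij jn; rewrite nu_w // eqSS (gtn_eqF a0) /nuk_basis /nuS_image /=.
have e1 : r ^ (j%:Z - a.+1%:Z - 2) = r ^+ j / (r ^+ 3 * r ^+ a).
  by rewrite -exprD -expz_natB; congr (_ ^ _); lia.
have e2 : r ^ (j%:Z - a.+1%:Z - 1) = r ^+ j / (r ^+ 2 * r ^+ a).
  by rewrite -exprD -expz_natB; congr (_ ^ _); lia.
have e3 : m / (l * r ^ (a.+1%:Z - i%:Z - 2)) = m / l * (r * r ^+ i / r ^+ a).
  have -> : (a.+1%:Z - i%:Z - 2) = a%:Z - i.+1%:Z by lia.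
  rewrite expz_natB exprS; field.
  by rewrite l0 r0 !expf_neq0.
by rewrite e1 e2 e3.
Qed.

Lemma nu1_w h i j : (0 < i < j)%N -> (j <= n)%N ->
  nu 1 (w h i j) = nu1_image l r w h i j.
Proof.
move=> ij jn; rewrite nu_w //= /nu1_basis /nu1_image.
have e c d : r ^ (c%:Z - d%:R) = r ^+ c / r ^+ d.
  by rewrite -expz_natB; congr (_ ^ _); lia.
have e2 d : r ^ (i%:Z + j%:Z - d%:R) = r ^+ i * r ^+ j / r ^+ d.
  by rewrite -exprD -expz_natB; congr (_ ^ _); lia.
by rewrite !e2 !e.
Qed.

Lemma nuP k c (u v : V) : nu k (c *: u + v) = c *: nu k u + nu k v.
Proof. exact: nu_is_linear. Qed.
Lemma nuD k (u v : V) : nu k (u + v) = nu k u + nu k v.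
Proof. exact: linearD. Qed.
Lemma nuN k (u : V) : nu k (- u) = - nu k u.
Proof. exact: linearN. Qed.
Lemma nuZ k c (u : V) : nu k (c *: u) = c *: nu k u.
Proof. exact: linearZ. Qed.
Lemma nu0 k : nu k 0 = 0.
Proof. exact: linear0. Qed.

Lemma nu_ext (f g : V -> V) :
  (forall a u v, f (a *: u + v) = a *: f u + f v) ->
  (forall a u v, g (a *: u + v) = a *: g u + g v) ->
  (forall h i j, (0 < i < j)%N -> (j <= n)%N -> f (w h i j) = g (w h i j)) ->
  f =1 g.
Proof.
move=> fP gP fg; apply: w_ind => // [a u v eu ev|]; first by rewrite fP gP eu ev.
have e0 (h : V -> V) : (forall a u v, h (a *: u + v) = a *: h u + h v) -> h 0 = 0.
  by move=> hP; move: (hP (-1) 0 0); rewrite scaler0 addr0 scaleN1r addNr.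
by rewrite !e0.
Qed.

Lemma braidS a v : (0 < a)%N -> (a.+2 <= n)%N ->
  nu a.+1 (nu a.+2 (nu a.+1 v)) = nu a.+2 (nu a.+1 (nu a.+2 v)).
Proof.
move=> a0 an; move: v.
apply: (@nu_ext (fun v => nu a.+1 (nu a.+2 (nu a.+1 v)))
  (fun v => nu a.+2 (nu a.+1 (nu a.+2 v))));
  try by move=> *; rewrite !nuP.
move=> h i j ij jn.
exact: (braidS_w l0 r0 vD vN vZ v_inj nuD nuN nuZ nuS_w).
Qed.

Lemma commSS a b v : (0 < a)%N -> (a.+1 < b)%N -> (b < n)%N ->
  nu a.+1 (nu b.+1 v) = nu b.+1 (nu a.+1 v).
Proof.
move=> a0 ab bn; move: v.
apply: (@nu_ext (fun v => nu a.+1 (nu b.+1 v))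
  (fun v => nu b.+1 (nu a.+1 v)));
  try by move=> *; rewrite !nuP.
move=> h i j ij jn.
exact: (commSS_w l0 r0 vD vN vZ v_inj nuD nuN nuZ nuS_w).
Qed.

Lemma comm12 v : (1 < n)%N -> nu 1 (nu 2 v) = nu 2 (nu 1 v).
Proof.
move=> n1; move: v.
apply: (@nu_ext (fun v => nu 1 (nu 2 v))
  (fun v => nu 2 (nu 1 v)));
  try by move=> *; rewrite !nuP.
move=> h i j ij jn.
exact: (comm12_w l0 r0 vD vN vZ v_inj nuD nuN nuZ nuS_w nu1_w).
Qed.

Lemma comm1S b v : (2 < b < n)%N -> nu 1 (nu b.+1 v) = nu b.+1 (nu 1 v).
Proof.
move=> bn; move: v.
apply: (@nu_ext (fun v => nu 1 (nu b.+1 v))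
  (fun v => nu b.+1 (nu 1 v)));
  try by move=> *; rewrite !nuP.
move=> h i j ij jn.
exact: (comm1S_w l0 r0 vD vN vZ v_inj nuD nuN nuZ nuS_w nu1_w).
Qed.

Lemma braid13 v : (2 < n)%N ->
  nu 1 (nu 3 (nu 1 v)) = nu 3 (nu 1 (nu 3 v)).
Proof.
move=> n2; move: v.
apply: (@nu_ext (fun v => nu 1 (nu 3 (nu 1 v)))
  (fun v => nu 3 (nu 1 (nu 3 v))));
  try by move=> *; rewrite !nuP.
move=> h i j ij jn.
exact: (braid13_w l0 r0 vD vN vZ v_inj nuD nuN nuZ nuS_w nu1_w).
Qed.

Lemma quad_line k x :
  (forall h i j, (0 < i < j)%N -> (j <= n)%N -> exists c,
    nu k (nu k (w h i j)) + m *: nu k (w h i j) - w h i j = c *: x) ->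
  forall v, exists c, nu k (nu k v) + m *: nu k v - v = c *: x.
Proof.
move=> hw; apply: w_ind => // [a u v [c1 e1] [c2 e2]|].
  exists (a * c1 + c2); rewrite scalerDl -scalerA -e1 -e2 !nuP.
  by apply: v_inj => b; rewrite !(vD, vN, vZ); ring.
by exists 0; rewrite !nu0 scaler0 addr0 subr0 scale0r.
Qed.

Lemma quadS a v : (0 < a)%N -> (a < n)%N -> exists c,
  nu a.+1 (nu a.+1 v) + m *: nu a.+1 v - v = c *: w false a a.+1.
Proof.
move=> a0 an; apply: quad_line v => h i j ij jn.
exact: (quadS_w l0 r0 vD vN vZ v_inj nuD nuN nuZ nuS_w).
Qed.

Lemma quad1 v : (1 < n)%N -> exists c,
  nu 1 (nu 1 v) + m *: nu 1 v - v = c *: w true 1 2.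
Proof.
move=> n1; apply: quad_line v => h i j ij jn.
exact: (quad1_w l0 r0 vD vN vZ v_inj nuD nuN nuZ nu1_w).
Qed.

Lemma nu_other a h (i j : nat) v : (0 < a)%N -> (a < n)%N -> i != a -> i != a.+1 ->
  j != a -> j != a.+1 ->
  co h i j (nu a.+1 v) = r * co h i j v.
Proof. exact: (co_nu_other l0 r0 (@coD F n) (@coN F n) (@coZ F n)
  (@co_w F n) (@w_ind F n) nuP nuS_w). Qed.

Lemma nu_self a v : (0 < a)%N -> (a < n)%N ->
  co true a a.+1 (nu a.+1 v) = r * co true a a.+1 v.
Proof. exact: (co_nu_self l0 r0 (@coD F n) (@coN F n) (@coZ F n)
  (@co_w F n) (@w_ind F n) nuP nuS_w). Qed.

Lemma nu_l a h s v : (0 < a)%N -> (a < n)%N -> (0 < s < a)%N ->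
  co h s a (nu a.+1 v) = co h s a.+1 v.
Proof. exact: (co_nu_l l0 r0 (@coD F n) (@coN F n) (@coZ F n)
  (@co_w F n) (@w_ind F n) nuP nuS_w). Qed.

Lemma nu_lS a h s v : (0 < a)%N -> (a < n)%N -> (0 < s < a)%N ->
  co h s a.+1 (nu a.+1 v) = co h s a v - m * co h s a.+1 v.
Proof. exact: (co_nu_lS l0 r0 (@coD F n) (@coN F n) (@coZ F n)
  (@co_w F n) (@w_ind F n) nuP nuS_w). Qed.

Lemma nu_r a h t v : (0 < a)%N -> (a < n)%N -> (a.+1 < t <= n)%N ->
  co h a t (nu a.+1 v) = co h a.+1 t v.
Proof. exact: (co_nu_r l0 r0 (@coD F n) (@coN F n) (@coZ F n)
  (@co_w F n) (@w_ind F n) nuP nuS_w). Qed.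

Lemma nu_rS a h t v : (0 < a)%N -> (a < n)%N -> (a.+1 < t <= n)%N ->
  co h a.+1 t (nu a.+1 v) = co h a t v - m * co h a.+1 t v.
Proof. exact: (co_nu_rS l0 r0 (@coD F n) (@coN F n) (@coZ F n)
  (@co_w F n) (@w_ind F n) nuP nuS_w). Qed.

Lemma nu_N a v : (0 < a)%N -> (a < n)%N ->
  co false a a.+1 (nu a.+1 v) = l^-1 * co false a a.+1 v
   + \sum_(a.+2 <= t < n.+1) m * (r ^+ t / (r ^+ 2 * r ^+ a)) * co false a.+1 t v
   + \sum_(a.+2 <= t < n.+1) m / l * (r ^+ t / (r ^+ 3 * r ^+ a)) * co true a.+1 t v
   + \sum_(1 <= s < a) m / l * (r * r ^+ s / r ^+ a) * co false s a.+1 v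
   + \sum_(1 <= s < a) m / l * (r * r ^+ s / r ^+ a) * co true s a.+1 v.
Proof. exact: (co_nu_N l0 r0 (@coD F n) (@coN F n) (@coZ F n)
  (@co_w F n) (@w_ind F n) nuP nuS_w). Qed.

Lemma nu1_1 v : (2 < n)%N ->
  co true 1 n (nu 1 v) = co false 2 n v + m * co false 1 n v
    + \sum_(3 <= i < n) m * (r ^+ i / r ^+ 3) * co true i n v.
Proof. exact: (co_nu1_1 l0 r0 (@coD F n) (@coN F n) (@coZ F n)
  (@co_w F n) (@w_ind F n) nuP nu1_w). Qed.

Lemma nu1_2 v : (2 < n)%N ->
  co true 2 n (nu 1 v) = co false 1 n v
    + \sum_(3 <= i < n) m * (r ^+ i / r ^+ 2) * co true i n v.
Proof. exact: (co_nu1_2 l0 r0 (@coD F n) (@coN F n) (@coZ F n)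
  (@co_w F n) (@w_ind F n) nuP nu1_w). Qed.

Lemma nu1_s s v : (2 < s < n)%N ->
  co true s n (nu 1 v) = r * co true s n v.
Proof. exact: (co_nu1_s l0 r0 (@coD F n) (@coN F n) (@coZ F n)
  (@co_w F n) (@w_ind F n) nuP nu1_w). Qed.

Lemma nu_wr a h j : (0 < a)%N -> (a.+1 < j <= n)%N ->
  nu a.+1 (w h a j) = w h a.+1 j.
Proof.
move=> a0 aj; rewrite nuS_w //; [|lia..]; rewrite /nuS_image eqxx.
by have -> : (j == a.+1) = false by lia.
Qed.

Lemma nu_wl a h i : (0 < i < a)%N -> (a < n)%N ->
  nu a.+1 (w h i a) = w h i a.+1.
Proof.
move=> ia an; rewrite nuS_w //; [|lia..]; rewrite /nuS_image.
have -> : (i == a) = false by lia.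
by rewrite eqxx.
Qed.

Lemma nu_wrS a j : (0 < a)%N -> (a.+1 < j <= n)%N ->
  nu a.+1 (w false a.+1 j) =
    w false a j + (m * (r ^+ j / (r ^+ 2 * r ^+ a))) *: w false a a.+1 - m *: w false a.+1 j.
Proof.
move=> a0 aj; rewrite nuS_w //; [|lia..]; rewrite /nuS_image.
have -> : (a.+1 == a) = false by lia.
have -> : (j == a) = false by lia.
by rewrite eqxx.
Qed.

Lemma nu_wlS a h i : (0 < i < a)%N -> (a < n)%N ->
  nu a.+1 (w h i a.+1) =
    w h i a + (m / l * (r * r ^+ i / r ^+ a)) *: w false a a.+1 - m *: w h i a.+1.
Proof.
move=> ia an; rewrite nuS_w //; [|lia..]; rewrite /nuS_image.
have -> : (i == a) = false by lia.
have -> : (i == a.+1) = false by lia.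
have -> : (a.+1 == a) = false by lia.
by rewrite eqxx.
Qed.

End Rep.

(** * Temperley-Lieb modules of type D *)

Section LinComb.
Variables (F : fieldType) (U : vectType F).
Definition bcoord (i : 'I_(\dim {:U})) (u : U) : F := coord (vbasis {:U}) i u.
Lemma bcoordD i u v : bcoord i (u + v) = bcoord i u + bcoord i v.
Proof. exact: linearD. Qed.
Lemma bcoordN i u : bcoord i (- u) = - bcoord i u.
Proof. exact: linearN. Qed.
Lemma bcoordZ i a u : bcoord i (a *: u) = a * bcoord i u.
Proof. exact: linearZ. Qed.
Lemma bcoord0 i : bcoord i 0 = 0.
Proof. exact: linear0. Qed.
Lemma bcoord_inj u v : (forall i, bcoord i u = bcoord i v) -> u = v.
Proof.
move=> uv; rewrite (coord_vbasis (memvf u)) (coord_vbasis (memvf v)).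
by apply: eq_bigr => i _; congr (_ *: _); apply: uv.
Qed.
End LinComb.

Ltac lincomb :=
  let i := fresh "i" in apply: bcoord_inj => i; rewrite ?(bcoordD, bcoordN, bcoordZ, bcoord0).

(** The Dynkin diagram of type D, each edge listed from its smaller end: the branch 1 - 3 and the
    chain 2 - 3 - ... - n. *)
Definition Dedge (i j : nat) : bool := ((i == 1) && (j == 3) || (1 < i) && (j == i.+1))%N.

Section TL.
Variables (F : fieldType) (U : vectType F) (E : nat -> 'End(U)) (n : nat) (r : F).
Let d : F := r + r^-1.

Hypothesis r0 : r != 0.
Hypothesis n4 : (4 <= n)%N.
Hypothesis dimU : \dim {:U} = n.
Hypothesis irrU : forall S : {vspace U},
  (forall k, (0 < k <= n)%N -> (E k @: S <= S)%VS) -> S = 0%VS \/ S = fullv.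
Hypothesis Eq : forall k x, (0 < k <= n)%N -> E k (E k x) = - d *: E k x.
Hypothesis Ecomm : forall i j x, (0 < i < j)%N -> (j <= n)%N -> ~~ Dedge i j ->
  E i (E j x) = E j (E i x).

Let g k (x : U) := E k x + r *: x.
Hypothesis braid : forall i j x, (0 < i < j)%N -> (j <= n)%N -> Dedge i j ->
  g i (g j (g i x)) = g j (g i (g j x)).

Let gE k x : E k x = g k x - r *: x.
Proof. by rewrite /g addrK. Qed.

Let gcomm i j x : (0 < i < j)%N -> (j <= n)%N -> ~~ Dedge i j ->
  g i (g j x) = g j (g i x).
Proof.
move=> ij jn e; rewrite /g !linearD !linearZ /= (Ecomm _ ij jn e); lincomb; ring.
Qed.

Let gB k x y : g k (x - y) = g k x - g k y.
Proof. by rewrite /g linearB /=; lincomb; ring. Qed.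
Let gZ k a x : g k (a *: x) = a *: g k x.
Proof. by rewrite /g linearZ /=; lincomb; ring. Qed.

(** If g_k x = 0 then E_k x = -r x, and E_k^2 = -d E_k gives r^2 x = d r x = (r^2 + 1) x. *)
Let g_inj k x : (0 < k <= n)%N -> g k x = 0 -> x = 0.
Proof.
move=> kn gx; have e : E k x = - r *: x.
  by rewrite gE gx; lincomb; ring.
have := Eq x kn; rewrite !e linearZ /= e scalerA => h.
have := subr0 (0 : U); rewrite -{1}(subrr (- d *: (- r *: x))) -{1}h subr0.
rewrite scalerA -scalerBl => /eqP; rewrite scaler_eq0 => /orP[|/eqP//].
have -> : - r * - r - - d * - r = -1 by rewrite /d; field.
by rewrite oppr_eq0 oner_eq0.
Qed.

Definition TLrel i j := forall x, E i (E j (E i x)) = E i x.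

(** Expanding the braid relation in the E's gives E_i E_j E_i - E_i = E_j E_i E_j - E_j, so both
    sides vanish together. *)
Lemma TLrel_sym i j : (0 < i < j)%N -> (j <= n)%N -> Dedge i j ->
  TLrel i j <-> TLrel j i.
Proof.
move=> ij jn e.
have h x : E i (E j (E i x)) - E i x = E j (E i (E j x)) - E j x.
  have := braid x ij jn e; rewrite /g ?(linearD, linearZ) /= ?(linearD, linearZ) /=.
  rewrite !Eq; try lia.
  move=> H; lincomb; move: (congr1 (bcoord i0) H); rewrite !(bcoordD, bcoordN, bcoordZ) => {}H.
  apply/eqP; rewrite -subr_eq0; apply/eqP.
  move/eqP: H; rewrite -subr_eq0 => /eqP <-; rewrite /d; field.
  by rewrite r0.
by split=> t x; apply/eqP; rewrite -subr_eq0; [rewrite -h|rewrite h]; rewrite t subrr.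
Qed.

(* Conjugation by g_i g_j g_k takes E_i to E_j and E_j to E_k. *)
Lemma TLrel_path i j k : (0 < i < j)%N -> (j < k)%N -> (k <= n)%N ->
  Dedge i j -> Dedge j k -> ~~ Dedge i k -> TLrel j k -> TLrel i j.
Proof.
move=> ij jk kn eij ejk eik t x.
pose X y := g i (g j (g k y)).
have Xi y : X (E i y) = E j (X y).
  rewrite !gE /X !gB !gZ; congr (_ - _).
  by rewrite -(@gcomm i k) ?(@braid i j) //; lia.
have Xj y : X (E j y) = E k (X y).
  rewrite !gE /X !gB !gZ; congr (_ - _).
  by rewrite (@braid j k) ?(@gcomm i k) //; lia.
apply/eqP; rewrite -subr_eq0; apply/eqP.
apply: (@g_inj k); first by lia.
apply: (@g_inj j); first by lia.
apply: (@g_inj i); first by lia.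
by rewrite !gB -!/(X _) Xi Xj Xi t subrr.
Qed.

(** When g_i is the scalar -1/r, the braid relation becomes r^-2 g_j = -r^-1 g_j^2, and cancelling
    the injective g_j leaves g_j = -1/r. *)
Lemma scalar_edge i j : (0 < i < j)%N -> (j <= n)%N -> Dedge i j ->
  ((forall x, E i x = - d *: x) <-> (forall x, E j x = - d *: x)).
Proof.
move=> ij jn e.
have gd k : (forall x, E k x = - d *: x) <-> (forall x, g k x = - r^-1 *: x).
  by split=> h x; [rewrite /g|rewrite gE]; rewrite h /d; lincomb; ring.
rewrite !gd; split=> h x; apply/eqP; rewrite -subr_eq0; apply/eqP.
  apply: (@g_inj j); first by lia.
  have := braid x ij jn e; rewrite !h !gZ ?h => /(congr1 (fun y => - r *: y)).
  rewrite !scalerA => H; rewrite gB gZ.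
  transitivity (- ((- r * - r^-1 * - r^-1) *: g j x - (- r * - r^-1) *: g j (g j x)));
    last by rewrite H subrr oppr0.
  by lincomb; field.
apply: (@g_inj i); first by lia.
have := braid x ij jn e; rewrite !h !gZ ?h => /(congr1 (fun y => - r *: y)).
rewrite !scalerA => H; rewrite gB gZ.
transitivity (- ((- r * - r^-1 * - r^-1) *: g i x - (- r * - r^-1) *: g i (g i x)));
  last by rewrite -H subrr oppr0.
by lincomb; field.
Qed.

Lemma no_common_eigenvector x : x != 0 ->
  (forall k, (0 < k <= n)%N -> exists c, E k x = c *: x) -> False.
Proof.
move=> x0 h; case: (irrU (S := <[x]>%VS)).
- move=> k kn; rewrite limg_line -memvE; case: (h k kn) => c ->.
  by rewrite memvZ // memv_line.
- by move=> /eqP; rewrite -dimv_eq0 dim_vline x0.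
- by move=> e; move: dimU; rewrite -e dim_vline x0; lia.
Qed.

Let dim_gt0 : exists x : U, x != 0.
Proof.
exists (vpick {:U}); rewrite vpick0; apply/negP => /eqP e.
by move: dimU; rewrite e dimv0; lia.
Qed.

(** By [scalar_edge] a scalar E_n would spread from node n down the chain to node 2, then from 3 to
    1, and every line would be invariant. *)
Lemma En_not_scalar : ~ (forall x, E n x = - d *: x).
Proof.
move=> h.
have hk t : (t + 2 <= n)%N -> forall x, E (n - t) x = - d *: x.
  elim: t => [|t IH] tn; first by rewrite subn0.
  apply/(@scalar_edge (n - t.+1) (n - t)); rewrite /Dedge; try lia.
  by apply: IH; lia.
have [x x0] := dim_gt0.
apply: (no_common_eigenvector x0) => k kn; exists (- d).
have [->|k1] := eqVneq k 1%N.
  have n3 : (3 <= n)%N by lia.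
  have [_ H] := @scalar_edge 1 3 isT n3 isT; apply: H.
  by have := hk (n - 3)%N; rewrite subKn; [apply|]; lia.
by have := hk (n - k)%N; rewrite subKn; [apply|]; lia.
Qed.

(** * Consequences of the Temperley-Lieb relation at the edge between n-1 and n *)

Section TLRelations.
Hypothesis TLn : TLrel n n.-1.

(** The relation descends the chain by conjugation, one edge at a time as far as 2 - 3; the branch 1
    - 3 is reached from 3 - 4. *)
Lemma TLedge i j : (0 < i < j)%N -> (j <= n)%N -> Dedge i j -> TLrel i j.
Proof.
have hk t : (t + 3 <= n)%N -> TLrel (n - t).-1 (n - t).
  elim: t => [|t IH] tn.
    by rewrite subn0; apply/TLrel_sym => //; rewrite /Dedge; lia.
  apply: (@TLrel_path _ _ (n - t)); rewrite /Dedge; try lia.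
  have -> : (n - t.+1 = (n - t).-1)%N by lia.
  by apply: IH; lia.
move=> ij jn /orP[/andP[/eqP-> /eqP->]|/andP[i1 /eqP ej]].
  apply: (@TLrel_path _ _ 4) => //.
  have := hk (n - 4)%N; rewrite subKn //; apply; lia.
have := hk (n - j)%N; rewrite subKn // ej /=; apply; lia.
Qed.

Lemma TLedge' i j : (0 < i < j)%N -> (j <= n)%N -> Dedge i j -> TLrel j i.
Proof.
by move=> ij jn e; have [H _] := TLrel_sym ij jn e; exact: H (TLedge ij jn e).
Qed.

Hypothesis d0 : d != 0.
Hypothesis d1 : d ^+ 2 != 1.
Hypothesis d2 : d ^+ 2 != 2%:R.

Definition Eimg k := limg (E k).
Local Notation A := Eimg.

(** As d is nonzero, -E_k/d is a projection, so the image of E_k is its eigenspace for -d. *)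
Lemma Eimg_P k y : (0 < k <= n)%N -> reflect (E k y = - d *: y) (y \in A k).
Proof.
move=> kn; apply: (iffP memv_imgP) => [[x _ ->]|e]; first exact: Eq.
exists (- d^-1 *: y); rewrite ?memvf // linearZ /= e scalerA.
by rewrite mulrNN mulVf // scale1r.
Qed.

Lemma mem_Eimg k x : E k x \in A k.
Proof. by apply: memv_img; rewrite memvf. Qed.

Lemma E_edge i j y : (0 < i < j)%N -> (j <= n)%N -> Dedge i j ->
  y \in A i -> E i (E j y) = y.
Proof. by move=> ij jn e /memv_imgP[x _ ->]; apply: TLedge. Qed.

Lemma E_edge' i j y : (0 < i < j)%N -> (j <= n)%N -> Dedge i j ->
  y \in A j -> E j (E i y) = y.
Proof. by move=> ij jn e /memv_imgP[x _ ->]; apply: TLedge'. Qed.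

Lemma Eimg_comm i j y : (0 < i <= n)%N -> (0 < j <= n)%N -> i != j ->
  ~~ Dedge i j -> ~~ Dedge j i ->
  y \in A i -> E j y \in A i.
Proof.
move=> hi hj ij e e' /(Eimg_P _ hi) ey; apply/(Eimg_P _ hi).
have [lt|ge] := ltnP i j; last first.
  by rewrite -Ecomm ?ey ?linearZ //; lia.
by rewrite Ecomm ?ey ?linearZ //; lia.
Qed.

(** E_j is injective on A_i because E_i E_j is the identity there, and symmetrically. *)
Lemma dim_Eimg_edge i j : (0 < i < j)%N -> (j <= n)%N -> Dedge i j ->
  \dim (A i) = \dim (A j).
Proof.
move=> ij jn e; apply/eqP; rewrite eqn_leq; apply/andP; split.
  rewrite -(@limg_dim_eq _ _ _ (E j) (A i)).
    by apply: dimvS; apply: limgS; apply: subvf.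
  apply/eqP; rewrite -subv0; apply/subvP => y /memv_capP[yi].
  by rewrite memv_ker memv0 => /eqP yj; rewrite -(E_edge ij jn e yi) yj linear0.
rewrite -(@limg_dim_eq _ _ _ (E i) (A j)).
  by apply: dimvS; apply: limgS; apply: subvf.
apply/eqP; rewrite -subv0; apply/subvP => y /memv_capP[yi].
by rewrite memv_ker memv0 => /eqP yj; rewrite -(E_edge' ij jn e yi) yj linear0.
Qed.

Lemma dim_Eimg k : (0 < k <= n)%N -> \dim (A k) = \dim (A n).
Proof.
have hk t : (t + 2 <= n)%N -> \dim (A (n - t)) = \dim (A n).
  elim: t => [|t IH] tn; first by rewrite subn0.
  rewrite -IH; last by lia.
  apply: dim_Eimg_edge; rewrite /Dedge; lia.
move=> kn; have [->|k1] := eqVneq k 1%N.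
  rewrite (@dim_Eimg_edge 1 3) //; last by lia.
  by have := hk (n - 3)%N; rewrite subKn; [apply|]; lia.
by have := hk (n - k)%N; rewrite subKn; [apply|]; lia.
Qed.

(** On a common vector y, E_n E_(n-1) y equals y by the edge relation and d^2 y by the two
    eigenvalues, while d^2 is not 1. *)
Lemma Eimg_cap : (A n :&: A n.-1 = 0)%VS.
Proof.
apply/eqP; rewrite -subv0; apply/subvP => y /memv_capP[yn yn1].
have e := E_edge' (i := n.-1) (j := n) _ (leqnn n) _ yn.
move/(Eimg_P _) : (yn) => /(_ _)H; move/(Eimg_P _) : (yn1) => /(_ _)H1.
have {}e : y = (d ^+ 2) *: y.
  by rewrite -{1}e ?H1 ?linearZ /= ?H ?scalerA ?mulrNN /Dedge; try lia.
rewrite memv0; move/eqP: e; rewrite -subr_eq0 -{1}[y]scale1r -scalerBl scaler_eq0.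
by rewrite subr_eq0 eq_sym (negbTE d1).
Qed.

Lemma dim_Eimg_double : (2 * \dim (A n) <= n)%N.
Proof.
have := dimvS (subvf (A n + A n.-1)); rewrite dimv_disjoint_sum ?Eimg_cap // dimU.
by rewrite (@dim_Eimg n.-1) ?mul2n ?addnn //; lia.
Qed.
(** All the A_k have the same dimension; were it 0, every E_k would vanish and every line would be
    invariant. *)
Lemma dim_Eimg_gt0 : (0 < \dim (A n))%N.
Proof.
rewrite lt0n; apply/negP => /eqP a0; have [x x0] := dim_gt0.
apply: (no_common_eigenvector x0) => k kn; exists 0.
have /eqP := dim_Eimg kn; rewrite a0 dimv_eq0 => /eqP Ak.
by have := mem_Eimg k x; rewrite Ak memv0 scale0r => /eqP.
Qed.

(* If U = A n + A n.-1 then no vector is killed by both E_n and E_{n-1}; applied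
   to a combination of x, E_{n-1} x and E_{n-2} E_{n-1} x, this shows that E_{n-2}
   is injective, hence equal to -d, on A n. *)
Lemma dim_Eimg_double_neq : (5 <= n)%N -> (2 * \dim (A n) != n)%N.
Proof.
move=> n5; apply/eqP => dA.
have aN0 : \dim (A n) != 0%N by lia.
have n1 : (0 < n.-1 < n)%N by lia.
have e1 : Dedge n.-1 n by rewrite /Dedge; lia.
have n2 : (0 < n.-2 < n.-1)%N by lia.
have e2 : Dedge n.-2 n.-1 by rewrite /Dedge; lia.
have n3 : (0 < n.-1.-2 < n.-2)%N by lia.
have e3 : Dedge n.-1.-2 n.-2 by rewrite /Dedge; lia.
have hn : (0 < n <= n)%N by lia.
have hn1 : (0 < n.-1 <= n)%N by lia.
have hn2 : (0 < n.-2 <= n)%N by lia.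
have le1 : (n.-1 <= n)%N by lia.
have le2 : (n.-2 <= n)%N by lia.
have hn3 : (0 < n.-1.-2 <= n)%N by lia.
have l2n : (0 < n.-2 < n)%N by lia.
have [m2 m3] : n != n.-2 /\ n != n.-1.-2 by split; apply/eqP; lia.
have [c2 c2'] : ~~ Dedge n n.-2 /\ ~~ Dedge n.-2 n by rewrite /Dedge; lia.
have [c3 c3'] : ~~ Dedge n n.-1.-2 /\ ~~ Dedge n.-1.-2 n by rewrite /Dedge; lia.
have full x : x \in (A n + A n.-1)%VS.
  suff -> : (A n + A n.-1 = fullv)%VS by apply: memvf.
  apply/eqP; rewrite eqEdim subvf dimU dimv_disjoint_sum ?Eimg_cap //.
  by rewrite /= (dim_Eimg hn1) -{1}dA mul2n -addnn.
have common x : E n x = 0 -> E n.-1 x = 0 -> x = 0.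
  have /memv_addP[q qA [p pA ->]] := full x; rewrite !linearD /=.
  have eq := elimT (Eimg_P _ hn) qA; have ep := elimT (Eimg_P _ hn1) pA.
  rewrite eq ep => h1 h2.
  have := congr1 (E n) h2; rewrite linearD linearZ /= linear0.
  rewrite (E_edge' n1 (leqnn n) e1 qA).
  have {}h1 : E n p = d *: q by rewrite -[LHS]subr0 -h1; lincomb; ring.
  rewrite h1 scalerA => h3.
  have q0 : q = 0.
    have : (1 - d ^+ 2) *: q = 0 by rewrite -h3; lincomb; ring.
    by move/eqP; rewrite scaler_eq0 subr_eq0 eq_sym (negbTE d1) => /eqP.
  move: h2; rewrite q0 linear0 add0r => /eqP.
  by rewrite scaler_eq0 oppr_eq0 (negbTE d0) add0r => /eqP.
have inj x : x \in A n -> E n.-2 x = 0 -> x = 0.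
  move=> xA e2x; have ex := elimT (Eimg_P _ hn) xA.
  pose t := E n.-2 (E n.-1 x).
  have et1 : E n.-1 t = E n.-1 x by rewrite /t (TLedge' n2 le1 e2).
  have etn : E n t = 0.
    rewrite /t -(Ecomm _ l2n (leqnn n) c2').
    by rewrite (E_edge' n1 (leqnn n) e1 xA).
  have ed : E n.-2 t = - d *: t by rewrite /t (Eq _ hn2).
  have v0 : (d ^+ 2 - 1) *: t + x + d *: E n.-1 x = 0.
    apply: common; rewrite !linearD !linearZ /=.
      by rewrite etn ex (E_edge' n1 (leqnn n) e1 xA); lincomb; ring.
    by rewrite et1 (Eq _ hn1); lincomb; ring.
  have := congr1 (E n.-2) v0; rewrite !linearD !linearZ /= linear0 e2x ed -/t => h.
  have t0 : t = 0.
    have : (d * (2%:R - d ^+ 2)) *: t = 0 by rewrite -h; lincomb; ring.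
    move/eqP; rewrite scaler_eq0 mulf_eq0 (negbTE d0) subr_eq0 eq_sym (negbTE d2).
    by move/eqP.
  have e1x : E n.-1 x = 0 by rewrite -et1 t0 linear0.
  by rewrite -(E_edge' n1 (leqnn n) e1 xA) e1x linear0.
have A24 y : y \in A n -> E n.-2 y = - d *: y.
  move=> yA; apply/eqP; rewrite -subr_eq0; apply/eqP; apply: inj.
    by rewrite rpredB ?rpredZ // Eimg_comm.
  by rewrite linearB linearZ /= (Eq _ hn2) subrr.
have : vpick (A n) != 0.
  by rewrite vpick0 -dimv_eq0.
move/negP; apply.
have yA := memv_pick (A n); set y := vpick _ in yA *.
(* Since n >= 5, node n-3 is a chain neighbour of n-2 that is not joined to n. Now y = E_(n-2)
   E_(n-3) y = -d E_(n-3) y, and squaring E_(n-3) forces d^2 = 1. *)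
have zA : E n.-1.-2 y \in A n by apply: Eimg_comm.
have y2 : y \in A n.-2 by apply/(Eimg_P _ hn2); apply: A24.
have ez : E n.-1.-2 y = - d^-1 *: y.
  have := A24 _ zA; rewrite (E_edge' n3 le2 e3 y2).
  by move=> {2}->; rewrite scalerA mulrNN mulVf // scale1r.
have : E n.-1.-2 (E n.-1.-2 y) = y.
  by rewrite (Eq _ hn3) ez scalerA mulrNN mulfV // scale1r.
rewrite ez linearZ /= ez scalerA => h.
have : (1 - d ^+ 2) *: y = 0.
  have := congr1 (fun z => (d ^+ 2) *: z) h; rewrite scalerA => {}h.
  rewrite scalerBl -h -scalerBl.
  by rewrite (_ : 1 - _ = 0) ?scale0r //; field.
by move/eqP; rewrite scaler_eq0 subr_eq0 eq_sym (negbTE d1).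
Qed.

(** * Action of the nodes at the branching end of the diagram *)

Lemma small_invariant (X : seq U) x : x \in X -> x != 0 -> (size X < n)%N ->
  (forall k y, (0 < k <= n)%N -> y \in X -> E k y \in <<X>>%VS) -> False.
Proof.
move=> xX x0 sX inv; case: (irrU (S := <<X>>%VS)).
- move=> k kn; rewrite limg_span; apply/span_subvP => _ /mapP[y yX ->].
  exact: inv.
- by move=> e; move: (memv_span xX); rewrite e memv0 (negbTE x0).
- by move=> e; have := dim_span X; rewrite e dimU; lia.
Qed.

(** Nodes 1, 2 and 4 are the neighbours of 3 and commute pairwise; for n = 4 they and 3 make up the
    whole diagram. *)
Let E3 k y : k \in [:: 1; 2; 4]%N -> y \in A k -> E k (E 3 y) = y.
Proof.
have h3 : (3 <= n)%N by lia.
by rewrite !inE => /or3P[]/eqP-> yA; [apply: E_edge|apply: E_edge|apply: E_edge'].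
Qed.
Let E3' k y : k \in [:: 1; 2; 4]%N -> y \in A 3 -> E 3 (E k y) = y.
Proof.
have h3 : (3 <= n)%N by lia.
by rewrite !inE => /or3P[]/eqP-> yA; [apply: E_edge'|apply: E_edge'|apply: E_edge].
Qed.
Let C124 p q x : p \in [:: 1; 2; 4]%N -> q \in [:: 1; 2; 4]%N -> E p (E q x) = E q (E p x).
Proof.
rewrite !inE => /or3P[]/eqP-> /or3P[]/eqP-> //;
 first [by apply: Ecomm => //; lia|by apply/esym; apply: Ecomm => //; lia].
Qed.

(** The span of u and E_3 u is invariant, of dimension at most 2. *)
Lemma D4_neg u : n = 4%N -> u != 0 -> (forall k, k \in [:: 1; 2; 4]%N -> E k u = - d *: u) -> False.
Proof.
move=> n4' u0 eu.
have h3 : (0 < 3 <= n)%N by lia.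
have [v ev] : {v | E 3 u = v} by exists (E 3 u).
have evv : E 3 v = - d *: v by rewrite -ev Eq.
have ekv k : (0 < k <= n)%N -> k \in [:: 1; 2; 4]%N -> E k v = u.
  by move=> kn k'; rewrite -ev E3 //; apply/(Eimg_P _ kn); apply: eu.
apply: (@small_invariant [:: u; v] u) => //; first by rewrite inE eqxx.
have uS : u \in <<[:: u; v]>>%VS by apply: memv_span; rewrite inE eqxx.
have vS : v \in <<[:: u; v]>>%VS by apply: memv_span; rewrite !inE eqxx orbT.
move=> k y kn; rewrite inE mem_seq1 => yX; have [k3|k3] := eqVneq k 3%N.
  by rewrite k3; case/orP: yX => /eqP->; rewrite ?ev ?evv ?rpredZ.
have k' : k \in [:: 1; 2; 4]%N by move: kn k3; rewrite n4' !inE; clear; lia.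
by case/orP: yX => /eqP->; rewrite ?(ekv _ kn k') // eu // rpredZ.
Qed.

(** The span of u, E_3 u and E_s E_3 u is invariant, of dimension at most 3. *)
Lemma D4_pos u p q s : n = 4%N -> u != 0 -> perm_eq [:: p; q; s] [:: 1; 2; 4]%N ->
  E p u = - d *: u -> E q u = - d *: u -> E s u = 0 -> False.
Proof.
move=> n4' u0 pqs ep eq es.
have mem k : (k \in [:: 1; 2; 4]%N) = (k \in [:: p; q; s]) by rewrite (perm_mem pqs).
have [mp mq ms] : [/\ p \in [:: 1; 2; 4]%N, q \in [:: 1; 2; 4]%N & s \in [:: 1; 2; 4]%N].
  by rewrite !mem !inE !eqxx !orbT.
have bnd k : k \in [:: 1; 2; 4]%N -> (0 < k <= n)%N.
  by rewrite !inE n4' => /or3P[]/eqP->.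
have h3 : (0 < 3 <= n)%N by lia.
have [v ev] : {v | E 3 u = v} by exists (E 3 u).
have [t et] : {t | E s v = t} by exists (E s v).
have vA : v \in A 3 by rewrite -ev; apply: mem_Eimg.
have epv : E p v = u by rewrite -ev E3 //; apply/(Eimg_P _ (bnd _ mp)).
have eqv : E q v = u by rewrite -ev E3 //; apply/(Eimg_P _ (bnd _ mq)).
have e3v : E 3 v = - d *: v by rewrite -ev Eq.
have e3t : E 3 t = v by rewrite -et E3'.
have est : E s t = - d *: t by rewrite -et Eq // bnd.
have ept : E p t = 0 by rewrite -et C124 // epv.
have eqt : E q t = 0 by rewrite -et C124 // eqv.
apply: (@small_invariant [:: u; v; t] u) => //; first by rewrite inE eqxx.
have uS : u \in <<[:: u; v; t]>>%VS by apply: memv_span; rewrite inE eqxx.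
have vS : v \in <<[:: u; v; t]>>%VS by apply: memv_span; rewrite !inE eqxx orbT.
have tS : t \in <<[:: u; v; t]>>%VS by apply: memv_span; rewrite !inE eqxx !orbT.
move=> k y kn; rewrite !inE => yX; have [k3|k3] := eqVneq k 3%N.
  by rewrite k3; case/or3P: yX => /eqP->; rewrite ?ev ?e3v ?e3t ?rpredZ.
have : k \in [:: 1; 2; 4]%N by move: kn k3; rewrite n4' !inE; clear; lia.
rewrite mem !inE => /or3P[] /eqP ek; rewrite ek; case/or3P: yX => /eqP->;
  by rewrite ?ep ?epv ?ept ?eq ?eqv ?eqt ?es ?et ?est ?rpredZ ?mem0v.
Qed.

(** Nodes 1, 2 and 3 are not joined to 5, so u, E_3 u and E_1 E_3 u all lie in A_5, whose dimension
    is at most 2; yet they are independent. *)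
Lemma D5_pos u : n = 5%N -> u != 0 -> u \in A 5 -> E 2 u = - d *: u -> E 1 u = 0 -> False.
Proof.
move=> n5 u0 u5 e2 e1.
have [h1 h2 h3 h5] : [/\ (0 < 1 <= n), (0 < 2 <= n), (0 < 3 <= n) & (0 < 5 <= n)]%N by split; lia.
have dA := dim_Eimg_double.
have [v ev] : {v | E 3 u = v} by exists (E 3 u).
have [t et] : {t | E 1 v = t} by exists (E 1 v).
have vA : v \in A 3 by rewrite -ev; apply: mem_Eimg.
have e2v : E 2 v = u by rewrite -ev E3 //; apply/(Eimg_P _ h2).
have e3t : E 3 t = v by rewrite -et E3'.
have e2t : E 2 t = 0 by rewrite -et C124 // e2v.
have e3v : E 3 v = - d *: v by rewrite -ev Eq.
have e1t : E 1 t = - d *: t by rewrite -et Eq.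
have v0 : v != 0 by apply: contra_neq u0 => v0; rewrite -e2v v0 linear0.
have t0 : t != 0 by apply: contra_neq v0 => t0; rewrite -e3t t0 linear0.
have v5 : v \in A 5 by rewrite -ev; apply: Eimg_comm.
have t5 : t \in A 5 by rewrite -et; apply: Eimg_comm.
have fr : free [tuple u; v; t].
  apply/freeP => c; rewrite !big_ord_recl big_ord0 /= addr0.
  set a := c _; set b := c _; set b' := c _ => h.
  (* Applying E_1, E_2 and E_3 to the relation gives b = d b', b = d a and a - d b + b' = 0, hence
     (2 - d^2) a = 0. *)
  have k1 := congr1 (E 1) h; have k2 := congr1 (E 2) h; have k3 := congr1 (E 3) h.
  move: k1 k2 k3; rewrite !linearD !linearZ /= !linear0 e1 e2 e2v ev e3v et e1t e2t e3t.
  move=> k1 k2 k3.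
  have {}k1 : (b - d * b') *: t = 0 by rewrite -k1; lincomb; ring.
  have {}k2 : (b - d * a) *: u = 0 by rewrite -k2; lincomb; ring.
  have {}k3 : (a - d * b + b') *: v = 0 by rewrite -k3; lincomb; ring.
  move/eqP: k1; rewrite scaler_eq0 (negbTE t0) orbF => /eqP k1.
  move/eqP: k2; rewrite scaler_eq0 (negbTE u0) orbF => /eqP k2.
  move/eqP: k3; rewrite scaler_eq0 (negbTE v0) orbF => /eqP k3.
  have eb : b = d * a by apply/eqP; rewrite -subr_eq0 k2.
  have eb' : b' = a.
    by apply: (mulfI d0); rewrite -eb; apply/eqP; rewrite eq_sym -subr_eq0 k1.
  have a0 : a = 0.
    have : a * (2%:R - d ^+ 2) = 0 by rewrite -k3 eb eb'; ring.
    by move/eqP; rewrite mulf_eq0 subr_eq0 [2%:R == _]eq_sym (negbTE d2) orbF => /eqP.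
  have b0 : b = 0 by rewrite eb a0 mulr0.
  have b'0 : b' = 0 by rewrite eb'.
  move=> [[|[|[|//]]] hi].
  - by rewrite -[RHS]a0; congr c; apply: val_inj.
  - by rewrite -[RHS]b0; congr c; apply: val_inj.
  - by rewrite -[RHS]b'0; congr c; apply: val_inj.
have sub : (<<[tuple u; v; t]>> <= A 5)%VS.
  by apply/span_subvP => y; rewrite !inE => /or3P[]/eqP->.
have := dimvS sub; rewrite (eqP fr) /=; rewrite -n5; clear -dA n5; lia.
Qed.

(** Otherwise E_1 u spans both lines A_1 and A_2, so A_2 + ... + A_n contains the images of all the
    E_k. This nonzero subspace is then invariant, of dimension at most n - 1. *)
Lemma E1_A2_eq0 u : \dim (A n) = 1%N -> u \in A 2 -> E 1 u = 0.
Proof.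
move=> a1 u2; apply/eqP/negP => /negP e0.
have k1 : (0 < 1 <= n)%N by lia.
have k2 : (0 < 2 <= n)%N by lia.
have line k : (0 < k <= n)%N -> E 1 u \in A k -> A k = <[E 1 u]>%VS.
  move=> kn ue; apply/esym/eqP; rewrite eqEdim dim_Eimg // a1 dim_vline e0 andbT.
  by rewrite -memvE.
have A12 : A 1 = A 2.
  have e2 : E 1 u \in A 2 by apply: Eimg_comm.
  by rewrite (line _ k1 (mem_Eimg 1 u)) (line _ k2 e2).
pose S := (\sum_(i < n.-1) A i.+2)%VS.
have AS k : (0 < k <= n)%N -> (A k <= S)%VS.
  move=> kn; have [->|k0] := eqVneq k 1%N.
    have h : (0 < n.-1)%N by lia.
    by rewrite A12; apply: (sumv_sup (Ordinal h)).
  have h : (k.-2 < n.-1)%N by lia.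
  apply: (sumv_sup (Ordinal h)) => //=.
  by rewrite (_ : k.-2.+2 = k) //; lia.
have dS : (\dim S < n)%N.
  apply: (@leq_ltn_trans (\sum_(i < n.-1) \dim (A i.+2))).
    rewrite /S; elim/big_rec2: _ => [|i x y _ xy]; first by rewrite dimv0.
    apply: leq_trans (_ : \dim (A i.+2) + \dim y <= _)%N; last by rewrite leq_add2l.
    by rewrite -dimv_sum_cap leq_addr.
  rewrite (eq_bigr (fun=> 1%N)) ?sum_nat_const ?card_ord; last first.
    by move=> i _; rewrite dim_Eimg //; have := ltn_ord i; lia.
  lia.
case: (irrU (S := S)).
- move=> k kn; apply: subv_trans (AS k kn); exact: limgS (subvf _).
- move=> S0; have := AS 2 k2; rewrite S0 subv0 -dimv_eq0 dim_Eimg // a1 //.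
- by move=> Sf; move: dS; rewrite Sf dimU ltnn.
Qed.

(** A_n is stable under E_j for j <= n - 2, so vanishing passes along edges by E_i = E_i E_j E_i:
    from 2 up the chain, and from 3 to 1. The hypothesis n >= 5 ensures 3 <= n - 2. *)
Lemma E2_zero : (5 <= n)%N -> (forall y, y \in A n -> E 2 y = 0) ->
  forall j y, (0 < j <= n - 2)%N -> y \in A n -> E j y = 0.
Proof.
move=> n5 h2.
have AC j y : (0 < j <= n - 2)%N -> y \in A n -> E j y \in A n.
  by move=> jn yA; apply: Eimg_comm; rewrite // /Dedge; lia.
have hk j y : (j.+2 <= n - 2)%N -> y \in A n -> E j.+2 y = 0.
  elim: j y => [|j IH] y jn yA; first exact: h2.
  rewrite -(@TLedge' j.+2 j.+3) ?IH ?linear0 //; rewrite /Dedge; try lia.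
  by apply: AC.
move=> [|[|j]] y jn yA //; last exact: hk.
rewrite -(@TLedge 1 3) //; last by lia.
rewrite (hk 1%N) ?linear0 //; first by lia.
by apply: AC.
Qed.
End TLRelations.

End TL.

(** * Invariant subspaces of dimension n *)

(** Applying f j to a vanishing combination leaves c times its j-th coefficient, so the family is
    free. The common factor c spares a normalisation. *)
Lemma dim_dual_family (F : fieldType) (V : vectType F) (A : {vspace V}) (I : finType)
    (x : I -> V) (f : I -> V -> F) (c : F) : c != 0 ->
  (forall i, scal (f i)) -> (forall i j, f j (x i) = c * (i == j)%:R) ->
  (forall i, x i \in A) -> (#|I| <= \dim A)%N.
Proof.
move=> c0 fP fx xA.
pose X := [tuple x (enum_val i) | i < #|I|].
have fr : free X.
  apply/freeP => k; rewrite (eq_bigr (fun i => k i *: x (enum_val i))); last first.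
    by move=> i _; rewrite -tnth_nth tnth_mktuple.
  move=> s0 j; have f0 : f (enum_val j) 0 = 0.
    by have := fP (enum_val j) (-1) 0 0; rewrite scaler0 addr0 mulN1r addNr.
  have := congr1 (f (enum_val j)) s0; rewrite f0.
  have -> : f (enum_val j) (\sum_i k i *: x (enum_val i)) =
     \sum_i k i * f (enum_val j) (x (enum_val i)).
    by apply: (big_rec2 (fun u y => f (enum_val j) u = y)) => // i y u _ <-; rewrite fP.
  rewrite (bigD1 j) //= fx eqxx big1 ?addr0 => [/eqP|i ij].
    by rewrite mulr1 mulf_eq0 (negbTE c0) orbF => /eqP.
  by rewrite fx (inj_eq enum_val_inj) (negbTE ij) mulr0 mulr0.
have sub : (<<X>> <= A)%VS.
  by apply/span_subvP => _ /mapP[i _ ->].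
by have := dimvS sub; rewrite (eqP fr) size_tuple.
Qed.

(* zify is very slow on contexts with membership or field hypotheses, so these
   are cleared first. *)
Ltac nlia :=
  repeat match goal with
  | H : ?T |- _ =>
    lazymatch T with
    | is_true (leq _ _) => fail
    | is_true (andb (leq _ _) (leq _ _)) => fail
    | is_true (negb (@eq_op _ ?x _)) =>
        let t := type of x in let t' := eval hnf in t in
        lazymatch t' with nat => fail | _ => clear H end
    | @eq nat _ _ => lazymatch T with context [dimv] => clear H | _ => fail end
    | nat => fail
    | _ => clear H
    end
  end; lia.

Section Main.
Variables (F : fieldType) (l r : F) (b : nat).
Hypotheses (l0 : l != 0) (r0 : r != 0) (b2 : (2 <= b)%N).
(* n = b + 2, so that no truncated subtraction occurs in the indices. *)
Local Notation n := b.+2.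
Let m : F := r^-1 - r.
Let d : F := r + r^-1.
Local Notation V := (Vn F n).
Local Notation nu := (@nu F l r n).
Local Notation w := (@w F n).
Local Notation co := (@co F n).

Lemma nu_comm i j v : (0 < i < j)%N -> (j <= n)%N -> ~~ Dedge i j ->
  nu i (nu j v) = nu j (nu i v).
Proof.
rewrite /Dedge => ij jn e.
have ej : j = j.-1.+1 by lia.
have [i1|i1] := eqVneq i 1%N.
  have [j2|j2] := eqVneq j 2%N; first by rewrite i1 j2; apply: comm12.
  have jb : (2 < j.-1 < n)%N by lia.
  by rewrite i1; move: (j.-1) ej jb => c -> jb; apply: comm1S.
have ei : i = i.-1.+1 by lia.
have [h1 h2 h3] : [/\ 0 < i.-1, i.-1.+1 < j.-1 & j.-1 < n]%N by split; lia.
by move: (i.-1) (j.-1) ei ej h1 h2 h3 => a c -> -> h1 h2 h3; apply: commSS.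
Qed.

Lemma nu_braid i j v : (0 < i < j)%N -> (j <= n)%N -> Dedge i j ->
  nu i (nu j (nu i v)) = nu j (nu i (nu j v)).
Proof.
rewrite /Dedge => ij jn e.
have [i1|i1] := eqVneq i 1%N.
  have -> : j = 3%N by lia.
  by rewrite i1; apply: braid13 => //; lia.
have ei : i = i.-1.+1 by lia.
have ej : j = i.-1.+2 by lia.
have [h1 h2] : (0 < i.-1)%N /\ (i.-1.+2 <= n)%N by lia.
by move: (i.-1) ei ej h1 h2 => a -> -> h1 h2; apply: braidS.
Qed.

Hypothesis d0 : d != 0.

(** Equivalently E_k v = -d v; inside W these vectors form the image of E_k. *)
Definition eig k (v : V) := nu k v = - r^-1 *: v.

Lemma eig0 (x : F) : - r^-1 * x = r * x -> x = 0.
Proof.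
move=> e; have : d * x = 0 by rewrite mulrDl -e; ring.
by move/eqP; rewrite mulf_eq0 (negbTE d0) => /eqP.
Qed.

(** On such a coordinate nu_(a+1) acts by r, which differs from -1/r because d is nonzero. *)
Lemma eig_other a h (i j : nat) v : (0 < a)%N -> (a < n)%N -> i != a -> i != a.+1 ->
  j != a -> j != a.+1 -> eig a.+1 v -> co h i j v = 0.
Proof.
move=> a0 an ia ia1 ja ja1 e; apply: eig0.
by rewrite -(coZ _ _ _ (- r^-1)) -e (nu_other l0 r0).
Qed.

Lemma eig_self a v : (0 < a)%N -> (a < n)%N -> eig a.+1 v -> co true a a.+1 v = 0.
Proof. by move=> a0 an e; apply: eig0; rewrite -(coZ _ _ _ (- r^-1)) -e (nu_self l0 r0). Qed.

Lemma eig_l a h s v : (0 < s < a)%N -> (a < n)%N -> eig a.+1 v ->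
  co h s a v = - r * co h s a.+1 v.
Proof.
move=> sa an e; have a0 : (0 < a)%N by lia.
rewrite -(nu_l l0 r0 h v a0 an sa) e coZ mulrA mulrNN divff ?mul1r //.
Qed.

Lemma eig_r a h t v : (0 < a)%N -> (a.+1 < t <= n)%N -> eig a.+1 v ->
  co h a t v = - r * co h a.+1 t v.
Proof.
move=> a0 ta e; have an : (a < n)%N by lia.
rewrite -(nu_r l0 r0 h v a0 an ta) e coZ mulrA mulrNN divff ?mul1r //.
Qed.

(** For the eigenvalue -1/r of nu_n, coordinates with both indices at most n-2 vanish, column n-1 is
    -r times column n, and hat w_(n-1,n) has coordinate 0. Only w_(n-1,n) escapes. *)
Lemma eig_n_inj v : eig n v -> (forall h s, (0 < s <= b)%N -> co h s n v = 0) ->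
  v = co false b.+1 n v *: w false b.+1 n.
Proof.
move=> e v0; apply: co_inj => h i j ij jn; rewrite coZ co_w //; last by lia.
have [jn'|jn'] := eqVneq j n.
  have [ib|ib] := eqVneq i b.+1.
    rewrite ib jn' ?eqxx /=; case: h; last by rewrite mulr1.
    by rewrite mulr0 eig_self.
  by rewrite jn' /= mulr0 v0 //; lia.
rewrite /= andbF mulr0.
have [jb|jb] := eqVneq j b.+1.
  by rewrite jb (eig_l (a := b.+1)) // ?v0 ?mulr0 //; lia.
by apply: (eig_other (a := b.+1)) => //; lia.
Qed.

Let n_gt2 : (2 < n)%N. Proof. by nlia. Qed.

Lemma eig_lin k c u v : eig k u -> eig k v -> eig k (c *: u + v).
Proof.
rewrite /eig nuP => -> ->.
by rewrite scalerDr !scalerA mulrC.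
Qed.

(** * Vectors that can generate E_n W *)

Lemma sum_triv k (e : F) :
  \sum_(3 <= i < k.+3) m * (r ^+ i / r ^+ 2) * (r ^+ i.-1 * e) =
  e * (r ^+ 2 - (r ^+ k.+2) ^+ 2 / r ^+ 2).
Proof.
(* The sum telescopes: its i-th term is e (r^(2i-4) - r^(2i-2)). *)
elim: k => [|k IH]; first by rewrite big_geq //; field.
by rewrite big_nat_recr //= IH /m !exprS; field; rewrite ?expf_neq0.
Qed.

Lemma sum_N k (e R : F) : R != 0 ->
  \sum_(1 <= s < k.+1) m / l * (r * r ^+ s / R) * (- r * (r ^+ s.-1 * e)) =
  - (e / l) * (r ^+ 2 - (r ^+ k.+1) ^+ 2) / R.
Proof.
(* Again telescoping: the s-th term is -(e/l) (r^(2s) - r^(2s+2)) / R. *)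
move=> R0; elim: k => [|k IH]; first by rewrite big_geq //; field; rewrite ?l0 ?R0 ?r0.
by rewrite big_nat_recr //= IH /m !exprS; field; rewrite ?expf_neq0 ?l0 ?R0.
Qed.

(** In terms of the E's: E_n acts by -d and every E_j with j <= n-2 kills v. *)
Definition triv_eig (v : V) :=
  eig n v /\ forall j, (0 < j <= b)%N -> nu j v = r *: v.

Lemma triv_eig_s v h s : triv_eig v -> (s < b)%N ->
  co h s.+1 n v = r ^+ s * co h 1 n v.
Proof.
move=> [ve vj]; elim: s => [|s IH] sb; first by rewrite mul1r.
rewrite exprS -mulrA -IH; last by nlia.
by rewrite -coZ -(vj s.+2) // (nu_r l0 r0) //; nlia.
Qed.

(** The equation nu_1 v = r v is read at hat w_(2,n), where the hatted coordinates form a geometric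
    progression and their sum telescopes. *)
Lemma triv_eig_1 v : triv_eig v ->
  co false 1 n v = (r ^+ b) ^+ 2 / r ^+ 2 * co true 1 n v.
Proof.
move=> vt; have [ve vj] := vt.
have b1 : (0 < 1 <= b)%N by nlia.
have := nu1_2 l0 r0 v n_gt2.
rewrite (vj _ b1) coZ big_nat_recr /=; last by nlia.
(* The last index i = n-1 breaks the progression, but hat w_(n-1,n) has coordinate 0. *)
rewrite [X in _ + (_ + X)](_ : _ = 0) ?addr0; last first.
  by rewrite (eig_self (a := b.+1)) ?mulr0.
have eb : b.+1 = b.-2.+3 by nlia.
have -> : \sum_(3 <= i < b.+1) m * (r ^+ i / r ^+ 2) * co true i n v =
   \sum_(3 <= i < b.-2.+3) m * (r ^+ i / r ^+ 2) * (r ^+ i.-1 * co true 1 n v).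
  rewrite -eb; apply: eq_big_nat => i ib; congr (_ * _).
  by rewrite -triv_eig_s //; [congr co|]; nlia.
rewrite sum_triv (_ : b.-2.+2 = b); last by nlia.
rewrite (@triv_eig_s v true 1) //.
move: (co false _ _ _) (co true _ _ _) (r ^+ b) => x y R e.
apply/eqP; rewrite -subr_eq0; apply/eqP; move/eqP: e; rewrite -subr_eq0 => /eqP e.
by rewrite -[RHS]oppr0 -e expr1; field.
Qed.

Lemma triv_eig_inj v : triv_eig v -> co true 1 n v = 0 -> co false b.+1 n v = 0 -> v = 0.
Proof.
move=> vt v0 vb; have [ve _] := vt.
rewrite (eig_n_inj ve) ?vb ?scale0r // => h [//|s] sb.
rewrite triv_eig_s //; case: h; first by rewrite v0 mulr0.
by rewrite triv_eig_1 // v0 !mulr0.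
Qed.

(* The generator of E_n W when W is the reflection module; the last coordinate
   is the one found in caseI_gamma2. *)
Definition refl_vector (v : V) :=
  [/\ triv_eig v, co true 1 n v = 1 &
      co false b.+1 n v = r ^+ b * ((r ^+ b) ^+ 2 / r ^+ 2 + 1)].

Lemma refl_vector_uniq u v : refl_vector u -> refl_vector v -> u = v.
Proof.
move=> [[ue uj] u1 ub] [[ve vj] v1 vb]; apply/eqP; rewrite -subr_eq0; apply/eqP.
have -> : u - v = (-1) *: v + u by rewrite scaleN1r addrC.
apply: triv_eig_inj; rewrite ?coP ?u1 ?v1 ?ub ?vb ?mulN1r ?addNr //.
split; first exact: eig_lin.
by move=> j jb; rewrite nuP uj // vj // scalerDr !scalerA mulrC.
Qed.

Lemma refl_vector_neq0 v : refl_vector v -> v != 0.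
Proof.
by move=> [_ v1 _]; apply/eqP => v0; move/eqP: v1; rewrite v0 co0 eq_sym oner_eq0.
Qed.

Lemma eig_n2 v h i : (2 < i < n)%N -> eig 2 v -> co h i n v = 0.
Proof. by move=> ib ve; apply: (eig_other (a := 1)) => //; nlia. Qed.

(** The condition at node 2 kills the coordinates at w_(s,n) and hat w_(s,n) with s > 2, including
    the one left free by [eig_n_inj], and ties index 1 to index 2. *)
Lemma eig_n2_inj v : eig n v -> eig 2 v -> (forall h, co h 2 n v = 0) -> v = 0.
Proof.
move=> en e2 v2; rewrite (eig_n_inj en).
  by rewrite eig_n2 ?scale0r //; nlia.
move=> h s sb; have [s1|s1] := eqVneq s 1%N.
  by rewrite s1 (eig_r (a := 1)) ?v2 ?mulr0 //; nlia.
have [->//|s2] := eqVneq s 2%N.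
by rewrite eig_n2 //; nlia.
Qed.

(* For n = 5, a vector of the module of shape (3,2) of Sym(5). *)
Definition two_row_vector (v : V) :=
  [/\ eig n v, eig 2 v, eig 1 v & co false 2 n v = 1].

(** The equation nu_1 v = -v/r is read at hat w_(2,n), where the sum over indices above 2
    vanishes. *)
Lemma two_row_hat v : eig 2 v -> eig 1 v ->
  co true 2 n v = r ^+ 2 * co false 2 n v.
Proof.
move=> e2 e1.
have := nu1_2 l0 r0 v n_gt2; rewrite e1 coZ big_nat big1 ?addr0; last first.
  by move=> i ib; rewrite eig_n2 ?mulr0.
rewrite (eig_r (a := 1)) //; last by nlia.
move=> e; apply: (mulfI (x := - r^-1)); first by rewrite oppr_eq0 invr_eq0.
by rewrite e; field.
Qed.

Lemma two_row_vector_uniq u v : two_row_vector u -> two_row_vector v -> u = v.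
Proof.
move=> [un u2 u1 uc] [vn v2 v1 vc]; apply/eqP; rewrite -subr_eq0; apply/eqP.
have -> : u - v = (-1) *: v + u by rewrite scaleN1r addrC.
apply: eig_n2_inj; try exact: eig_lin.
have c0 : co false 2 n (-1 *: v + u) = 0 by rewrite coP uc vc mulN1r addNr.
by case=> //; rewrite two_row_hat ?c0 ?mulr0 //; apply: eig_lin.
Qed.

Lemma two_row_vector_neq0 v : two_row_vector v -> v != 0.
Proof.
by move=> [_ _ _ v1]; apply/eqP => v0; move/eqP: v1; rewrite v0 co0 eq_sym oner_eq0.
Qed.

Hypotheses (d1 : d ^+ 2 != 1) (d2 : d ^+ 2 != 2%:R).

(** * An invariant subspace of dimension n as a module for the operators E_k *)

Section Invariant.
Variable W : {vspace V}.
Hypothesis W_inv : invariant_subspace l r W.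
Hypothesis W_dim : \dim W = n.

Lemma W_nu k v : (0 < k <= n)%N -> v \in W -> nu k v \in W.
Proof. by move=> kn; apply: W_inv. Qed.

(** From w_12 the operators produce all w_(1,j) and w_(2,j), hatted or not as [h] says: 2n - 3 > n
    independent vectors. *)
Lemma w12_notin h : w h 1 2 \notin W.
Proof.
apply/negP => w12.
have w1 j : (j.+2 <= n)%N -> w h 1 j.+2 \in W.
  elim: j => [|j IH] jn //.
  by rewrite -(@nu_wl _ l r) //; apply: W_nu => //; apply: IH; lia.
have w2 j : (j.+3 <= n)%N -> w h 2 j.+3 \in W.
  by move=> jn; rewrite -(@nu_wr _ l r) //; apply: W_nu; rewrite // w1.
pose x (i : 'I_b.+1 + 'I_b) := match i with inl i => w h 1 i.+2 | inr i => w h 2 i.+3 end.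
pose f (i : 'I_b.+1 + 'I_b) := match i with inl i => co h 1 i.+2 | inr i => co h 2 i.+3 end.
have := @dim_dual_family F V W _ x f 1 (oner_neq0 _).
rewrite card_sum !card_ord W_dim => H.
suff : (b.+1 + b <= n)%N by lia.
apply: H => [[i|i] a u v|[i|i] [j|j]|[i|i]] /=; rewrite ?coP // ?mul1r.
- by rewrite co_w ?eqxx ?andbT // ltnS ltn_ord.
- by rewrite co_w // ltnS ltn_ord.
- by rewrite co_w // !ltnS ltn_ord.
- by rewrite co_w ?eqxx ?andbT // !ltnS ltn_ord.
- by apply: w1; rewrite ltnS ltn_ord.
- by apply: w2; rewrite !ltnS ltn_ord.
Qed.

(** Membership would descend to w_12. If w_(a+1,a+2) is in W, applying nu_(a+1) puts w_(a,a+2) + m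
    w_(a,a+1) in W, and applying nu_(a+2) to that isolates w_(a,a+1). *)
Lemma wS_notin a : (0 < a < n)%N -> w false a a.+1 \notin W.
Proof.
elim: a => [//|a IH] an; have [->|a0] := posnP a; first exact: w12_notin.
have an' : (0 < a < n)%N by lia.
apply/negP => wW; move: (IH an') => /negP; apply.
have mE : m * (r ^+ a.+2 / (r ^+ 2 * r ^+ a)) = m.
  by rewrite -exprD addSn addSn add0n divff ?mulr1 // expf_neq0.
have h1 : w false a a.+2 + m *: w false a a.+1 \in W.
  have an2 : (a.+1 < a.+2 <= n)%N by lia.
  have := nu_wrS l0 r0 a0 an2; rewrite mE => /(canLR (subrK _)) e.
  by rewrite -e rpredD ?rpredZ //; apply: W_nu => //; lia.
have /(W_nu (k := a.+2)) := h1; rewrite nuD nuZ.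
rewrite (nu_wl l0 r0) //; [|lia]; rewrite (nu_wlS l0 r0) //; [|lia].
have an3 : (0 < a.+2 <= n)%N by lia.
move=> /(_ an3); set q := _ / _ * _ => h2.
suff -> : w false a a.+1 = (w false a a.+1 + q *: w false a.+1 a.+2 -
    m *: w false a a.+2 + m *: w false a a.+2) - q *: w false a.+1 a.+2.
  by rewrite rpredB // rpredZ.
by rewrite subrK addrK.
Qed.

(** The defect lies in W and is a multiple of w_(k-1,k), or of hat w_12 for k = 1, which is not in
    W. *)
Lemma W_quad k v : (0 < k <= n)%N -> v \in W -> nu k (nu k v) + m *: nu k v - v = 0.
Proof.
move=> kn vW.
have xW : nu k (nu k v) + m *: nu k v - v \in W.
  by rewrite rpredB // rpredD ?rpredZ ?W_nu.
have line x c : x \notin W -> nu k (nu k v) + m *: nu k v - v = c *: x ->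
    nu k (nu k v) + m *: nu k v - v = 0.
  move=> xW' e; move: xW; rewrite e; have [->|c0] := eqVneq c 0; first by rewrite scale0r.
  by rewrite rpredZeq (negbTE c0) (negbTE xW').
case: k kn xW line => [//|[|k]] kn xW line.
  by have [c e] := quad1 l0 r0 v (isT : (1 < n)%N); apply: line e; apply: w12_notin.
have [//|c e] := @quadS F l r n l0 r0 k.+1 v isT.
by apply: line e; apply: wS_notin.
Qed.

Local Notation U := (subvs_of W).

(** The projection [vsproj] only serves to land in the subspace type; by invariance it changes
    nothing for 1 <= k <= n. *)
Definition Efun k (x : U) : U := vsproj W (nu k (vsval x) - r *: vsval x).

Lemma EfunE k x : (0 < k <= n)%N ->
  vsval (Efun k x) = nu k (vsval x) - r *: vsval x.
Proof.
by move=> kn; rewrite vsprojK // rpredB ?rpredZ ?W_nu ?subvsP.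
Qed.

Lemma Efun_linear k : linear (Efun k).
Proof.
move=> a x y; rewrite /Efun -linearP; congr (vsproj W _).
by rewrite !linearP /=; apply: bcoord_inj => i; rewrite !(bcoordD, bcoordN, bcoordZ); ring.
Qed.
HB.instance Definition _ k := GRing.isLinear.Build F U U *:%R (Efun k) (Efun_linear k).

Lemma End_exists : exists E : nat -> 'End(U), forall k x, (0 < k <= n)%N ->
  vsval (E k x) = nu k (vsval x) - r *: vsval x.
Proof.
exists (fun k => linfun (Efun k)) => k x kn.
by rewrite lfunE EfunE.
Qed.

Variable E : nat -> 'End(U).
Hypothesis valE : forall k x, (0 < k <= n)%N ->
  vsval (E k x) = nu k (vsval x) - r *: vsval x.

Lemma valD (x y : U) : vsval (x + y) = vsval x + vsval y.
Proof. exact: linearD. Qed.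
Lemma valZ c (x : U) : vsval (c *: x) = c *: vsval x.
Proof. exact: linearZ. Qed.
Lemma val0 : vsval (0 : U) = 0.
Proof. exact: linear0. Qed.

Lemma valg k x : (0 < k <= n)%N -> vsval (E k x + r *: x) = nu k (vsval x).
Proof. by move=> kn; rewrite valD valZ valE // subrK. Qed.

Lemma E_quad k x : (0 < k <= n)%N -> E k (E k x) = - d *: E k x.
Proof.
move=> kn; apply: subvs_inj; rewrite valZ !(valE _ kn) nuD nuN nuZ.
have /(canRL (subrK _)) := W_quad kn (subvsP x); rewrite add0r => /(canRL (addrK _)) ->.
by move: (nu k _) => A1; move: (vsval x) => A2; rewrite /d /m; lincomb; field.
Qed.

Lemma E_comm i j x : (0 < i < j)%N -> (j <= n)%N -> ~~ Dedge i j -> E i (E j x) = E j (E i x).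
Proof.
move=> ij jn e; have [hi hj] : (0 < i <= n)%N /\ (0 < j <= n)%N by lia.
apply: subvs_inj.
rewrite (valE (E j x) hi). rewrite (valE x hj).
rewrite (valE (E i x) hj). rewrite (valE x hi).
rewrite nuD. rewrite nuN. rewrite nuZ.
rewrite nuD nuN nuZ.
suff -> : nu i (nu j (vsval x)) = nu j (nu i (vsval x)).
  move: (nu j (nu i _)) => A1; move: (nu i _) => A2; move: (nu j _) => A3; move: (vsval x) => A4.
  by lincomb; ring.
exact: nu_comm.
Qed.

Lemma E_braid i j x : (0 < i < j)%N -> (j <= n)%N -> Dedge i j ->
  let g k y := E k y + r *: y in g i (g j (g i x)) = g j (g i (g j x)).
Proof.
move=> ij jn e g; have [hi hj] : (0 < i <= n)%N /\ (0 < j <= n)%N by lia.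
apply: subvs_inj; rewrite /g !(valg _ hi, valg _ hj) {g}.
exact: nu_braid.
Qed.

Lemma dimU : \dim {:U} = n.
Proof. by rewrite dimvf /dim /= W_dim. Qed.

Hypothesis W_irr : forall S : {vspace V}, invariant_subspace l r S ->
  (S <= W)%VS -> S = 0%VS \/ S = W.

Lemma irrU (S : {vspace U}) :
  (forall k, (0 < k <= n)%N -> (E k @: S <= S)%VS) -> S = 0%VS \/ S = fullv.
Proof.
move=> Sinv; pose S' := (linfun (vsval : U -> V) @: S)%VS.
have S'P v : v \in S' -> exists2 x, x \in S & v = vsval x.
  by case/memv_imgP => x xS ->; exists x; rewrite ?lfunE.
have memS' x : x \in S -> vsval x \in S'.
  by move=> xS; rewrite -[vsval x]lfunE; apply: memv_img.
have [//| |S0|SW] := W_irr (S := S').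
- move=> k kn v /S'P[x xS ->].
  rewrite -valg //; apply: memS'; rewrite rpredD ?rpredZ //.
  by apply: subvP (Sinv k kn) _ _; apply: memv_img.
- by apply/subvP => v /S'P[x xS ->]; apply: subvsP.
- left; apply/eqP; rewrite -subv0; apply/subvP => x /memS'.
  by rewrite S0 !memv0 => /eqP x0; apply/eqP/subvs_inj; rewrite x0 val0.
- right; apply/eqP; rewrite eqEsubv subvf /=; apply/subvP => x _.
  have : vsval x \in S' by rewrite SW subvsP.
  by case/S'P => y yS /subvs_inj->.
Qed.


Local Notation A := (Eimg E).

Lemma AP k y : (0 < k <= n)%N -> reflect (E k y = - d *: y) (y \in A k).
Proof. by move=> kn; apply: (Eimg_P E_quad). Qed.

Lemma A_eig k y : (0 < k <= n)%N -> y \in A k -> eig k (vsval y).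
Proof.
move=> kn /(AP _ kn) e; rewrite /eig -valg // e -valZ; congr (vsval _).
by rewrite /d; lincomb; ring.
Qed.

(** By [eig_n_inj] only a multiple of w_(n-1,n) remains, and that vector is not in W. *)
Lemma An_inj y : y \in A n -> (forall h s, (0 < s <= b)%N -> co h s n (vsval y) = 0) ->
  y = 0.
Proof.
move=> yA y0; have nn : (0 < n <= n)%N by lia.
have := eig_n_inj (A_eig nn yA) y0; set c := co _ _ _ _ => e.
have [c0|c0] := eqVneq c 0; first by apply: subvs_inj; rewrite val0 e c0 scale0r.
have : c *: w false b.+1 n \in W by rewrite -e subvsP.
by rewrite rpredZeq (negbTE c0) (negbTE (wS_notin (a := b.+1) _)) //; lia.
Qed.

Lemma coE_E k h i j x : (0 < k <= n)%N ->
  co h i j (vsval (E k x)) = co h i j (nu k (vsval x)) - r * co h i j (vsval x).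
Proof. by move=> kn; rewrite valE // coD coN coZ. Qed.

Lemma co_En h s x : (0 < s < b.+1)%N ->
  co h s n (vsval (E n x)) = co h s b.+1 (vsval x) - r^-1 * co h s n (vsval x).
Proof.
move=> sb; have nn : (0 < n <= n)%N by lia.
by rewrite coE_E // (nu_lS l0 r0) // /m; ring.
Qed.

(** * Coordinates of E_n E_(n-1) y - y for y in the image of E_n *)

Section EPred.
Variable y : U.
Hypothesis yA : y \in A n.
Let nn : (0 < n <= n)%N. Proof. by lia. Qed.
Let bn : (0 < b.+1 <= n)%N. Proof. by lia. Qed.
Let b0 : (0 < b)%N. Proof. by lia. Qed.
Let ye : eig n (vsval y) := A_eig nn yA.

Lemma co_Epred1 h s : (0 < s < b)%N ->
  co h s b.+1 (vsval (E b.+1 y)) = co h s n (vsval y).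
Proof.
move=> sb; rewrite coE_E // (nu_lS l0 r0) // (eig_other (a := b.+1)) //; try lia.
by rewrite (eig_l (a := b.+1)) // /m; [field|lia].
Qed.

Lemma co_Epred2 h s : (0 < s < b)%N -> co h s n (vsval (E b.+1 y)) = 0.
Proof.
move=> sb; rewrite coE_E // (nu_other l0 r0) ?subrr //; lia.
Qed.

Lemma co_Epred3 : co true b b.+1 (vsval (E b.+1 y)) = 0.
Proof. by rewrite coE_E // (nu_self l0 r0) ?subrr. Qed.

Lemma co_Epred4 h : co h b n (vsval (E b.+1 y)) =
  co h b.+1 n (vsval y) - r * co h b n (vsval y).
Proof. by rewrite coE_E // (nu_r l0 r0) //; lia. Qed.

Lemma co_true_last : co true b.+1 n (vsval y) = 0.
Proof. exact: eig_self. Qed.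

Lemma kappa_A : E n (E b.+1 y) - y \in A n.
Proof. by rewrite rpredB // mem_Eimg. Qed.

(** For s < n-2, E_(n-1) moves the coordinates of y from column n to column n-1 and E_n moves them
    back. At hat w_(n-2,n) the cancellation also needs the coordinate of y at hat w_(n-1,n) to be 0;
    its unhatted analogue is unknown, hence the exception. *)
Lemma kappa_co h s : (0 < s <= b)%N -> ~~ h && (s == b) = false ->
  co h s n (vsval (E n (E b.+1 y) - y)) = 0.
Proof.
move=> sb hs; have -> : vsval (E n (E b.+1 y) - y) = vsval (E n (E b.+1 y)) - vsval y.
  exact: linearB.
rewrite coD coN co_En; last by lia.
have [esb|nsb] := eqVneq s b; last first.
  by rewrite co_Epred1 ?co_Epred2 ?mulr0 ?subr0 ?subrr //; lia.
move: hs; rewrite esb eqxx andbT => /negbFE ->.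
by rewrite co_Epred3 co_Epred4 co_true_last; field.
Qed.
End EPred.


Let nn : (0 < n <= n)%N. Proof. by lia. Qed.
Let n4 : (4 <= n)%N. Proof. by lia. Qed.

Lemma EA j y : (0 < j <= b)%N -> y \in A n -> E j y \in A n.
Proof.
move=> jb; apply: (Eimg_comm r0 n4 dimU E_quad E_comm d0 d1 d2); rewrite /Dedge; lia.
Qed.

Lemma gA j y c : (0 < j <= b)%N -> y \in A n -> exists2 x, x \in A n &
  vsval x = nu j (vsval y) + c *: vsval y.
Proof.
move=> jb yA; exists (E j y + r *: y + c *: y).
  by rewrite !rpredD ?rpredZ ?EA.
by rewrite valD valg ?valZ //; lia.
Qed.

(* Such a z would make every choice of the coordinates at w_{s,n} and hat w_{s,n},
   s <= n - 2, occur in E_n W. *)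
Section Kappa.
Variables (z : U) (c : F).
Hypotheses (zA : z \in A n) (c0 : c != 0).
Hypothesis zE : forall h s, (0 < s <= b)%N ->
  co h s n (vsval z) = c * (~~ h && (s == b))%:R.

(** The operator nu_(s+1) + m moves the coordinate from w_(s+1,n) to w_(s,n); adding m cancels what
    nu_(s+1) leaves behind. *)
Lemma kappa_false t : (t < b)%N -> exists2 x, x \in A n &
  forall h i, (0 < i <= b)%N -> co h i n (vsval x) = c * (~~ h && (i == b - t)%N)%:R.
Proof.
elim: t => [|t IH] tb; first by exists z => // h i ib; rewrite zE // subn0.
have [x xA xE] := IH (ltnW tb).
pose s := (b - t.+1)%N; have es : (b - t)%N = s.+1 by rewrite /s; nlia.
have sb : (0 < s.+1 <= b)%N by nlia.
have s0 : (0 < s)%N by nlia.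
have [x' x'A x'E] := gA m sb xA.
exists x' => // h i ib; rewrite x'E coD coZ -/s.
have sn : (s.+1 < n <= n)%N by nlia.
have [->|is1] := eqVneq i s.
  rewrite (nu_r l0 r0) // ?xE //; try nlia.
  by rewrite es eqxx [s == _]eqn_leq ltnn andbF andbF mulr0 mulr0 addr0.
have [->|is2] := eqVneq i s.+1.
  rewrite (nu_rS l0 r0) // ?xE //; try nlia.
  by rewrite es [s == _]eqn_leq ltnn !andbF mulr0 -/m /=; ring.
rewrite (nu_other l0 r0) // ?xE //; try nlia.
by rewrite es (negbTE is2) !andbF /=; ring.
Qed.

(** nu_1 carries the coordinate from w_(2,n) to hat w_(1,n), and nu_2, nu_3, ... then push it
    upwards. Unhatted coordinates are left unspecified. *)
Lemma kappa_true s : (s < b)%N -> exists2 x, x \in A n &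
  forall i, (0 < i <= b)%N -> co true i n (vsval x) = c * (i == s.+1)%:R.
Proof.
elim: s => [|s IH] sb.
  have [x xA xE] := kappa_false (t := b.-2) ltac:(nlia).
  have e2 : (b - b.-2 = 2)%N by nlia.
  rewrite e2 in xE.
  have b1 : (0 < 1 <= b)%N by nlia.
  have [x' x'A x'E] := gA 0 b1 xA.
  exists x' => // i ib; rewrite x'E scale0r addr0.
  have sum0 k : \sum_(3 <= i < n) m * (r ^+ i / r ^+ k) * co true i n (vsval x) = 0.
    rewrite big_nat big1 // => j jn; have [->|jb] := eqVneq j b.+1.
      by rewrite co_true_last // mulr0.
    by rewrite xE /= ?mulr0 //; nlia.
  have [->|i1] := eqVneq i 1%N.
    rewrite nu1_1 // sum0 !xE //=.
    by rewrite mulr0 mulr1; ring.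
  have [->|i2] := eqVneq i 2%N.
    by rewrite nu1_2 // sum0 !xE //= !mulr0 addr0.
  by rewrite nu1_s ?xE //= ?mulr0 //; nlia.
have [x xA xE] := IH (ltnW sb).
have sb' : (0 < s.+2 <= b)%N by nlia.
have [x' x'A x'E] := gA 0 sb' xA.
exists x' => // i ib; rewrite x'E scale0r addr0.
have sn : (s.+2 < n <= n)%N by nlia.
have [->|is1] := eqVneq i s.+1.
  rewrite (nu_r l0 r0) // ?xE //; try nlia.
  by rewrite (gtn_eqF (ltnSn _)) (ltn_eqF (ltnSn _)) mulr0.
have [->|is2] := eqVneq i s.+2.
  rewrite (nu_rS l0 r0) // ?xE //; try nlia.
  by rewrite (gtn_eqF (ltnSn _)) ?eqxx !mulr0 subr0.
rewrite (nu_other l0 r0) // ?xE //; try nlia.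
by rewrite (negbTE is1) !mulr0.
Qed.

Lemma kappa_contra : False.
Proof.
have H0 (t : 'I_b) : exists2 x, x \in A n & forall h (i : 'I_b),
    co h i.+1 n (vsval x) = c * (~~ h && (i == t))%:R.
  have tb := ltn_ord t; have tb' : (b - t.+1 < b)%N by nlia.
  have [x xA xE] := kappa_false tb'.
  exists x => // h i; rewrite xE; last by have := ltn_ord i; nlia.
  by rewrite subKn // eqSS.
have H1 (t : 'I_b) : exists2 x, x \in A n & forall i : 'I_b,
    co true i.+1 n (vsval x) = c * (i == t)%:R.
  have [x xA xE] := kappa_true (ltn_ord t).
  by exists x => // i; rewrite xE ?eqSS //; have := ltn_ord i; nlia.
have [X XA XE] := fin_all_exists2 H0.
have H2 (t : 'I_b) : exists2 x, x \in A n & forall h (i : 'I_b),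
    co h i.+1 n (vsval x) = c * (h && (i == t))%:R.
  have [x xA xE] := H1 t.
  (* The X i have no hatted coordinates, so this combination removes the unhatted coordinates of x
     without disturbing the hatted ones. *)
  pose k (i : 'I_b) := co false i.+1 n (vsval x) / c.
  exists (x - \sum_i k i *: X i).
    by rewrite rpredB // rpred_sum // => i _; rewrite rpredZ.
  move=> h i; have -> : vsval (x - \sum_i k i *: X i) = vsval x - \sum_i k i *: vsval (X i).
    by rewrite linearB linear_sum; congr (_ - _); apply: eq_bigr => j _; rewrite linearZ.
  have coS : co h i.+1 n (\sum_i k i *: vsval (X i)) = \sum_j k j * co h i.+1 n (vsval (X j)).
    apply: (big_rec2 (fun u y => co h i.+1 n u = y)); first exact: co0.
    by move=> j y u _ <-; rewrite coP.
  rewrite coD coN coS (bigD1 i) //= XE eqxx andbT big1 ?addr0; last first.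
    by move=> j ji; rewrite XE eq_sym (negbTE ji) andbF !mulr0.
  case: h {coS} => /=; first by rewrite xE !mulr0 subr0.
  by rewrite /k mulr1 divfK // subrr mulr0.
have [Y YA YE] := fin_all_exists2 H2.
pose x (p : bool * 'I_b) := if p.1 then Y p.2 else X p.2.
pose f (p : bool * 'I_b) (u : U) := co p.1 p.2.+1 n (vsval u).
have := @dim_dual_family F U (A n) _ x f c c0.
rewrite card_prod card_bool card_ord => H.
have {}H : (2 * b <= \dim (A n))%N.
  apply: H => [[h i] a u v|[h i] [h' j]|[h i]]; rewrite /f /x /=.
  - by rewrite coP.
  - by rewrite xpair_eqE; case: h; case: h'; rewrite ?XE ?YE //= eq_sym.
  - by case: h.
(* For n = 4 the bound 2(n-2) <= n is an equality, so the count alone is no contradiction; it makes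
   A_n everything and E_n scalar. *)
have le := dimvS (subvf (A n)); rewrite dimU in le.
have full : A n = fullv by apply/eqP; rewrite eqEdim subvf dimU; nlia.
apply: (En_not_scalar r0 n4 dimU irrU E_quad E_braid) => y.
by apply/(AP _ nn); rewrite full memvf.
Qed.
End Kappa.

(** The defect z has no coordinate to be controlled except at w_(n-2,n); a nonzero value there is
    excluded by [kappa_contra], and [An_inj] then gives z = 0. *)
Lemma TLn : TLrel E n n.-1.
Proof.
move=> x; set y := E n x; have yA : y \in A n by apply: mem_Eimg.
apply/eqP; rewrite -subr_eq0; apply/eqP; set z := _ - y.
have zA : z \in A n by apply: kappa_A.
have [c0|c0] := eqVneq (co false b n (vsval z)) 0; last first.
  case: (kappa_contra zA c0) => h s sb.
  have [hs|hs] := boolP (~~ h && (s == b)); last by rewrite mulr0 kappa_co //; apply/negbTE.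
  by case/andP: hs => /negbTE-> /eqP->; rewrite mulr1.
apply: An_inj => // h s sb; have [hs|hs] := boolP (~~ h && (s == b)).
  by case/andP: hs => /negbTE-> /eqP->.
by rewrite kappa_co //; apply/negbTE.
Qed.


Let TLrec := E_edge' r0 n4 dimU E_quad E_comm E_braid TLn.

(** * First case: every E_j with j <= n-2 kills the image of E_n *)

Section CaseI.
Hypothesis hI : forall j y, (0 < j <= b)%N -> y \in A n -> E j y = 0.

Lemma caseI_triv y : y \in A n -> triv_eig (vsval y).
Proof.
move=> yA; split=> [|j jb]; first exact: A_eig.
by rewrite -valg ?hI ?add0r ?valZ //; nlia.
Qed.

Lemma caseI_inj y : y \in A n -> co true 1 n (vsval y) = 0 -> y = 0.
Proof.
move=> yA y0; have yt := caseI_triv yA; apply: An_inj => // h [//|s] sb.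
rewrite triv_eig_s //; case: h; first by rewrite y0 mulr0.
by rewrite triv_eig_1 // y0 !mulr0.
Qed.

(** The coordinate at hat w_(1,n) is an injective linear form on A_n. *)
Lemma caseI_dim : \dim (A n) = 1%N.
Proof.
have a0 : (0 < \dim (A n))%N.
  exact: (dim_Eimg_gt0 r0 n4 dimU irrU E_quad E_comm E_braid TLn d0 d1 d2).
have yA := memv_pick (A n); set y := vpick _ in yA.
have y0 : y != 0 by rewrite vpick0 -dimv_eq0 -lt0n.
apply/eqP; rewrite eqn_leq a0 andbT.
apply: leq_trans (_ : \dim <[y]>%VS <= _)%N; last by rewrite dim_vline y0.
apply/dimvS/subvP => x xA; apply/vlineP.
exists (co true 1 n (vsval x) / co true 1 n (vsval y)).
have c0 : co true 1 n (vsval y) != 0.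
  by apply: contra_neq y0 => c0; apply: caseI_inj.
apply/eqP; rewrite -subr_eq0; apply/eqP; apply: caseI_inj.
  by rewrite rpredB ?rpredZ.
set k := _ / _; have -> : vsval (x - k *: y) = vsval x - k *: vsval y.
  by rewrite linearB linearZ.
by rewrite coD coN coZ /k divfK // subrr.
Qed.

Variable y : U.
Hypotheses (yA : y \in A n) (y1 : co true 1 n (vsval y) = 1).
(** R is r^(n-2), T the ratio of unhatted to hatted coordinates from [triv_eig_1], and g the
    coordinate at w_(n-1,n), the last unknown. *)
Let R := r ^+ b.
Let T := R ^+ 2 / r ^+ 2.
Let g := co false b.+1 n (vsval y).
Let yt := caseI_triv yA.
Let ye : eig n (vsval y) := proj1 yt.
Let R0 : R != 0. Proof. by rewrite expf_neq0. Qed.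
Let Rb : r * r ^+ b.-1 = R. Proof. by rewrite -exprS prednK //; nlia. Qed.

Let cy h s : (0 < s <= b)%N -> co h s n (vsval y) = r ^+ s.-1 * (if h then 1 else T).
Proof.
case: s => [//|s] sb; rewrite triv_eig_s //=; congr (_ * _).
by case: h; rewrite ?triv_eig_1 // y1 ?mulr1.
Qed.

(* From the coordinate of E_n E_{n-1} y = y at w_{n-2,n}. *)
Lemma caseI_gamma1 : g = (R ^+ 3 / r ^+ 2 - l^-1 * r / R).
Proof.
have b0 : (0 < b < b.+1)%N by nlia.
have bb : (0 < b <= b)%N by nlia.
have bn : (0 < b.+1 <= n)%N by nlia.
have ed : Dedge b.+1 n by rewrite /Dedge; nlia.
have bn' : (0 < b.+1 < n)%N by nlia.
have cb h : co h b b.+1 (vsval y) = - r * co h b n (vsval y).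
  by apply: (eig_l (a := b.+1)).
have := congr1 (fun x : U => co false b n (vsval x)) (TLrec bn' (leqnn n) ed yA).
rewrite /= co_En // co_Epred4 // coE_E // cb cy //= -/g.
rewrite (nu_N l0 r0) //; [|nlia..].
rewrite cb cy //= big_nat1 -/g big_nat1 co_true_last // mulr0 addr0.
have sumE h e : e = (if h then 1 else T) ->
  \sum_(1 <= s < b) m / l * (r * r ^+ s / r ^+ b) * co h s b.+1 (vsval y) =
   - (e / l) * (r ^+ 2 - R ^+ 2) / R.
  move=> eh; have eb : b = b.-1.+1 by nlia.
  have -> : \sum_(1 <= s < b) m / l * (r * r ^+ s / r ^+ b) * co h s b.+1 (vsval y) =
     \sum_(1 <= s < b.-1.+1) m / l * (r * r ^+ s / R) * (- r * (r ^+ s.-1 * e)).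
    rewrite -eb; apply: eq_big_nat => s sb; congr (_ * _).
    by rewrite (eig_l (a := b.+1)) ?cy ?eh //; nlia.
  by rewrite sum_N // -eb.
rewrite (sumE false T) // (sumE true 1) // -/R [r ^+ n]exprS [r ^+ b.+1]exprS -/R.
rewrite -Rb /T -Rb; have P0 : r ^+ b.-1 != 0 by rewrite expf_neq0.
move: (r ^+ b.-1) P0 => P P0 e.
apply/eqP; rewrite -subr_eq0; apply/eqP; move/eqP: e; rewrite -subr_eq0 => /eqP e.
(* The difference of the two sides of the goal is -1/r times that of the equation [e]; such a
   multiplier closes the similar computations below. *)
by rewrite -[RHS](mulr0 (- r^-1)) -e /m; field; rewrite ?l0 ?P0 ?r0.
Qed.

(** The vector is E_(n-1-t) ... E_(n-1) y. Each new factor copies the coordinate from w_(s+1,n) to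
    w_(s,n), because the previous vector, an eigenvector of nu_(s+2), has coordinate 0 at
    w_(s,n). *)
Lemma caseI_chain t : (t < b)%N -> exists2 x, x \in A (b - t).+1 &
  forall h, co h (b - t) n (vsval x) = co h b.+1 n (vsval y) - r * co h b n (vsval y).
Proof.
elim: t => [|t IH] tb.
  by rewrite subn0; exists (E b.+1 y); [apply: mem_Eimg|move=> h; apply: co_Epred4].
have [x xA xE] := IH (ltnW tb).
pose s := (b - t.+1)%N; have es : (b - t)%N = s.+1 by rewrite /s; nlia.
rewrite -/s; rewrite es in xA xE.
have [s0 sn hs] : [/\ 0 < s, s.+1 < n <= n & 0 < s.+1 <= n]%N by rewrite /s; split; nlia.
have hs2 : (0 < s.+2 <= n)%N by rewrite /s; nlia.
exists (E s.+1 x); first exact: mem_Eimg.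
move=> h; rewrite coE_E // (nu_r l0 r0) // xE.
have -> : co h s n (vsval x) = 0.
  have xe := A_eig hs2 xA.
  by apply: (eig_other (a := s.+1)) => //; rewrite /s; nlia.
by rewrite mulr0 subr0.
Qed.

(* From E_1 x = 0, where x is a multiple of E_2 ... E_{n-1} y. *)
Lemma caseI_gamma2 : g = R * (T + 1).
Proof.
have tb : (b.-1 < b)%N by nlia.
have [x xA xE] := caseI_chain tb.
have e1 : (b - b.-1 = 1)%N by nlia.
rewrite e1 in xA xE.
have n2 : (0 < 2 <= n)%N by nlia.
have n1 : (0 < 1 <= n)%N by nlia.
have x0 : E 1 x = 0.
  exact: (E1_A2_eq0 r0 n4 dimU irrU E_quad E_comm E_braid TLn d0 d1 d2 caseI_dim).
have x2 := A_eig n2 xA.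
have := nu1_2 l0 r0 (vsval x) n_gt2; rewrite big_nat big1 ?addr0; last first.
  by move=> i ib; rewrite eig_n2 ?mulr0.
rewrite -valg // x0 add0r valZ coZ.
have e2 h : co h 1 n (vsval x) = - r * co h 2 n (vsval x).
  by apply: (eig_r (a := 1)) => //; nlia.
have -> : r * co true 2 n (vsval x) = - co true 1 n (vsval x) by rewrite e2; ring.
have bb : (0 < b <= b)%N by nlia.
rewrite !xE co_true_last // !(cy _ bb) /= -/g => e; rewrite -Rb.
apply/eqP; rewrite -subr_eq0; apply/eqP; move/eqP: e; rewrite -subr_eq0 => /eqP e.
by rewrite -[RHS]oppr0 -e; ring.
Qed.

(** Equating the two values of g leaves 1/l = -R^2/r, that is l = -1/r^(2n-5). *)
Lemma caseI_l : l = - (r / R ^+ 2).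
Proof.
have := caseI_gamma1; rewrite caseI_gamma2 /T => e.
have {}e : l^-1 = - (R ^+ 2 / r).
  apply/eqP; rewrite -subr_eq0; apply/eqP; move/eqP: e; rewrite -subr_eq0 => /eqP e.
  by rewrite -[RHS](mulr0 (R / r)) -e; field; rewrite ?l0 ?R0 ?r0.
by rewrite -[LHS]invrK e invrN invf_div.
Qed.

Lemma caseI_refl : refl_vector (vsval y).
Proof. by split=> //; apply: caseI_gamma2. Qed.

End CaseI.


Lemma caseI_conclusion : (forall j y, (0 < j <= b)%N -> y \in A n -> E j y = 0) ->
  l = - (r / (r ^+ b) ^+ 2) /\ exists2 v, v \in W & refl_vector v.
Proof.
move=> hI.
have yA := memv_pick (A n); set y := vpick _ in yA.
have y0 : y != 0 by rewrite vpick0 -dimv_eq0 (caseI_dim hI).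
have c0 : co true 1 n (vsval y) != 0.
  by apply: contra_neq y0 => c0; apply: caseI_inj c0.
pose y' := (co true 1 n (vsval y))^-1 *: y.
have y'A : y' \in A n by rewrite rpredZ.
have y'1 : co true 1 n (vsval y') = 1 by rewrite valZ coZ mulVf.
split; first exact: caseI_l y'1.
by exists (vsval y'); [apply: subvsP|apply: caseI_refl].
Qed.

(** * Second case: some E_j with j <= n-2 does not kill the image of E_n *)

Lemma split_eigen j k y : (0 < j <= b)%N -> (0 < k <= b)%N ->
  (forall x, E j (E k x) = E k (E j x)) -> y \in A n -> E j y != 0 ->
  exists2 u, u != 0 & [/\ u \in A n, E j u = - d *: u & E k u = 0 \/ E k u = - d *: u].
Proof.
move=> jb kb jk yA y0.
have jn : (0 < j <= n)%N by nlia.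
have kn : (0 < k <= n)%N by nlia.
(* E_j y serves if E_k kills it, and E_k E_j y otherwise. *)
have [k0|k0] := eqVneq (E k (E j y)) 0.
  exists (E j y) => //; split; [exact: EA|exact: E_quad|by left].
exists (E k (E j y)) => //; split; first by rewrite !EA.
  by rewrite jk E_quad // linearZ.
by right; apply: E_quad.
Qed.

(** Were u nonzero, nu_3, ..., nu_(n-2) would move its coordinate at w_(2,n) or hat w_(2,n) to the
    indices 3, ..., n-2, so n - 3 <= dim A_n, against 2 dim A_n < n. *)
Lemma caseII_dim u : (4 <= b)%N -> u \in A n -> E 2 u = - d *: u -> u = 0.
Proof.
move=> b4 uA u2; have n2 : (0 < 2 <= n)%N by nlia.
have u2e : eig 2 (vsval u) by apply: A_eig => //; apply/AP.
have [[h hu]|] : (exists h, co h 2 n (vsval u) != 0) \/ forall h, co h 2 n (vsval u) = 0.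
- have [h0|h0] := eqVneq (co false 2 n (vsval u)) 0; last by left; exists false.
  have [h1|h1] := eqVneq (co true 2 n (vsval u)) 0; last by left; exists true.
  by right; case.
- exfalso; pose c := co h 2 n (vsval u).
  have fam s : (s.+2 <= b)%N -> exists2 x, x \in A n & forall i, (1 < i <= b)%N ->
      co h i n (vsval x) = c * (i == s.+2)%:R.
    elim: s => [|s IH] sb.
      exists u => // i ib; have [->|i2] := eqVneq i 2%N; first by rewrite mulr1.
      by rewrite mulr0 eig_n2 //; nlia.
    have [x xA xE] := IH (ltnW sb).
    have sb' : (0 < s.+3 <= b)%N by nlia.
    have [x' x'A x'E] := gA 0 sb' xA.
    exists x' => // i ib; rewrite x'E scale0r addr0.
    have sn : (s.+3 < n <= n)%N by nlia.
    have [->|is1] := eqVneq i s.+2.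
      rewrite (nu_r l0 r0) // ?xE //; try nlia.
      by rewrite (gtn_eqF (ltnSn _)) (ltn_eqF (ltnSn _)) mulr0.
    have [->|is2] := eqVneq i s.+3.
      rewrite (nu_rS l0 r0) // ?xE //; try nlia.
      by rewrite (gtn_eqF (ltnSn _)) ?eqxx !mulr0 subr0.
    rewrite (nu_other l0 r0) // ?xE //; try nlia.
    by rewrite (negbTE is1) !mulr0.
  have fam' (t : 'I_b.-1) : exists2 x, x \in A n & forall i : 'I_b.-1,
      co h i.+2 n (vsval x) = c * (i == t)%:R.
    have tb : (t.+2 <= b)%N by have := ltn_ord t; nlia.
    have [x xA xE] := fam t tb.
    by exists x => // i; rewrite xE ?eqSS //; have := ltn_ord i; nlia.
  have [X XA XE] := fin_all_exists2 fam'.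
  have := @dim_dual_family F U (A n) _ X (fun i u => co h i.+2 n (vsval u)) c hu.
  rewrite card_ord => H.
  have {}H : (b.-1 <= \dim (A n))%N.
    by apply: H => [i a v v'|i j|i] //=; rewrite ?coP ?XE // eq_sym.
  have h1 := dim_Eimg_double r0 n4 dimU E_quad E_comm E_braid TLn d0 d1 d2.
  have n5 : (4 < n)%N by nlia.
  have h2 := dim_Eimg_double_neq r0 n4 dimU E_quad E_comm E_braid TLn d0 d1 d2 n5.
  by move: H h1 h2; move: (\dim _) => a H h1 h2; nlia.
- move=> u0; apply: subvs_inj; rewrite val0.
  exact: (eig_n2_inj (A_eig nn uA) u2e u0).
Qed.

(** [split_eigen] at the nodes 1 and 2 yields a vector of A_4 excluded by [D4_pos] or by
    [D4_neg]. *)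
Lemma caseII_4 : b = 2%N -> (exists j y, [/\ (0 < j <= b)%N, y \in A n & E j y != 0]) -> False.
Proof.
move=> eb [j [y [jb yA y0]]].
have n4' : n = 4%N by rewrite eb.
have [b1 b2'] : (0 < 1 <= b)%N /\ (0 < 2 <= b)%N by nlia.
have [n1 n2] : (0 < 1 < 2)%N /\ (2 <= n)%N by nlia.
have C x : E 1 (E 2 x) = E 2 (E 1 x) by apply: E_comm.
have e4 u : u \in A n -> E 4 u = - d *: u.
  by move=> /(AP _ nn) <-; rewrite -[in LHS]n4'.
have pos := D4_pos r0 n4 dimU irrU E_quad E_comm E_braid TLn d0 d1 d2.
have neg := D4_neg r0 n4 dimU irrU E_quad E_comm E_braid TLn d0 d1 d2.
have [ej|ej] : j = 1%N \/ j = 2%N by move: jb; rewrite eb; clear; lia.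
  rewrite ej in y0; have [u u0 [/e4 u4 u1 [u2|u2]]] := split_eigen b1 b2' C yA y0.
    exact: (pos u 1%N 4%N 2%N).
  by apply: (neg u) => // k; rewrite !inE => /or3P[]/eqP->.
rewrite ej in y0.
have [u u0 [/e4 u4 u2 [u1|u1]]] := split_eigen b2' b1 (fun x => esym (C x)) yA y0.
  exact: (pos u 2%N 4%N 1%N).
by apply: (neg u) => // k; rewrite !inE => /or3P[]/eqP->.
Qed.


(** With u' = E_4 u, the relation E_4 E_3 u' = u' is read at w_(2,4); E_3 brings in 1/l through the
    coordinate at w_(2,3). *)
Lemma caseII_5 u : b = 3%N -> u \in A n -> u \in A 2 -> u \in A 1 ->
  co false 2 n (vsval u) = 1 -> l = r ^+ 3.
Proof.
move=> eb uA u2A u1A c1.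
have [b1 b22] : (0 < 1 <= b)%N /\ (0 < 2 <= b)%N by nlia.
have [n1 n2] : (0 < 1 <= n)%N /\ (0 < 2 <= n)%N by nlia.
have [n3 nb1] : (0 < 3 <= n)%N /\ (0 < b.+1 <= n)%N by nlia.
have h2b : (0 < 2 < b)%N by nlia.
have bb1 : (0 < b < b.+1)%N by nlia.
have bn1 : (b.+1 <= n)%N by nlia.
have bn : (b < n)%N by nlia.
have b0 : (0 < b)%N by nlia.
have edb : Dedge b b.+1 by rewrite /Dedge; nlia.
have hat : co true 2 n (vsval u) = r ^+ 2.
  by rewrite two_row_hat ?c1 ?mulr1 //; apply: A_eig.
have [u' eu'] : {u' | E b.+1 u = u'} by exists (E b.+1 u).
have u'2 : u' \in A 2.
  by rewrite -eu'; apply: (Eimg_comm r0 n4 dimU E_quad E_comm d0 d1 d2); rewrite // /Dedge; nlia.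
have u'b : u' \in A b.+1 by rewrite -eu'; apply: mem_Eimg.
have cu h : co h 2 b.+1 (vsval u') = if h then r ^+ 2 else 1.
  by rewrite -eu' (co_Epred1 uA h h2b); case: h.
have cu3 h : co h 2 3 (vsval u') = - r * (if h then r ^+ 2 else 1).
  rewrite -cu -(eig_l (a := b) h h2b bn (A_eig nb1 u'b)).
  by congr (co h _ _ _); rewrite eb.
have cu13 h : co h 1 3 (vsval u') = - r * (- r * (if h then r ^+ 2 else 1)).
  by rewrite -cu3; apply: (eig_r (a := 1)) => //; apply: A_eig.
have z3 h i t : (2 < i)%N -> (2 < t)%N -> co h i t (vsval u') = 0.
  move=> i2 t2; have e2 := A_eig n2 u'2.
  by apply: (eig_other (a := 1)) => //; nlia.
have eE : E b u' = E 3 u' by congr (E _ u'); rewrite eb.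
have := congr1 (fun x : U => co false 2 b.+1 (vsval x)) (TLrec bb1 bn1 edb u'b).
rewrite /= eE coE_E // (nu_lS l0 r0) // cu.
have -> : co false 2 b (vsval (E 3 u')) = co false 2 3 (vsval (E 3 u')).
  by congr (co false _ _ _); rewrite eb.
have a2 : (2 < n)%N := n_gt2.
have t3 : (3 < b.+1 <= n)%N by nlia.
rewrite !coE_E // cu3 cu (@nu_r _ l r _ l0 r0 2 false b.+1) // z3 //.
rewrite (nu_N l0 r0) // big_nat big1; last first.
  by move=> t tb; rewrite z3 ?mulr0 //; nlia.
rewrite big_nat big1; last by move=> t tb; rewrite z3 ?mulr0 //; nlia.
rewrite !big_nat1 !cu13 cu3 -/m => e.
have {}e : l^-1 = (r ^+ 3)^-1.
  apply/eqP; rewrite -subr_eq0; apply/eqP; move/eqP: e; rewrite -subr_eq0 => /eqP e.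
  by rewrite -[RHS](mulr0 (- (r ^+ 5)^-1)) -e /m; field; rewrite ?l0 ?r0.
by rewrite -[LHS]invrK e invrK.
Qed.

Lemma caseII_5_conclusion u : b = 3%N -> u != 0 -> u \in A n -> E 2 u = - d *: u ->
  E 1 u = - d *: u -> l = r ^+ 3 /\ exists2 v, v \in W & two_row_vector v.
Proof.
move=> eb u0 uA e2 e1.
have [n1 n2] : (0 < 1 <= n)%N /\ (0 < 2 <= n)%N by nlia.
have uA2 : u \in A 2 by apply/AP.
have uA1 : u \in A 1 by apply/AP.
have c0 : co false 2 n (vsval u) != 0.
  apply: contra_neq u0 => c0; apply: subvs_inj; rewrite val0.
  apply: (eig_n2_inj (A_eig nn uA) (A_eig n2 uA2)).
  by case=> //; rewrite (two_row_hat (A_eig n2 uA2) (A_eig n1 uA1)) c0 mulr0.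
pose u' := (co false 2 n (vsval u))^-1 *: u.
have u'1 : co false 2 n (vsval u') = 1 by rewrite valZ coZ mulVf.
have [u'A u'A2 u'A1] : [/\ u' \in A n, u' \in A 2 & u' \in A 1].
  by split; rewrite rpredZ.
split; first exact: (caseII_5 eb u'A u'A2 u'A1).
exists (vsval u'); first exact: subvsP.
by split=> //; apply: A_eig.
Qed.

Lemma invariant_cases :
  (l = - (r / (r ^+ b) ^+ 2) /\ exists2 v, v \in W & refl_vector v) \/
  [/\ b = 3%N, l = r ^+ 3 & exists2 v, v \in W & two_row_vector v].
Proof.
have [[j [y [jb yA y0]]]|hI] := pselect (exists j y, [/\ (0 < j <= b)%N, y \in A n & E j y != 0]);
  last first.
  left; apply: caseI_conclusion => j y jb yA; apply/eqP/negP => /negP y0.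
  by apply: hI; exists j, y.
have [eb|nb2] := eqVneq b 2%N.
  by case: (caseII_4 eb); exists j, y.
have [n5 b1 b22 n1 n2] : [/\ 4 < n, 0 < 1 <= b, 0 < 2 <= b, 0 < 1 < 2 & 2 <= n]%N by split; nlia.
have C x : E 2 (E 1 x) = E 1 (E 2 x) by apply/esym/E_comm.
(* If E_2 killed A_n, so would every E_j with j <= n-2 by [E2_zero], contrary to the choice of j and
   y. *)
have [y' y'A y'0] : exists2 y', y' \in A n & E 2 y' != 0.
  apply/not_exists2P => h; case/eqP: y0.
  apply: (E2_zero r0 n4 dimU E_quad E_comm E_braid TLn d0 d1 d2 n5) => // [x xA|].
    by apply/eqP; have [|/negP/negPn] := h x.
  by rewrite subn2.
have [u u0 [uA u2 u1]] := split_eigen b22 b1 C y'A y'0.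
have [b4|b4] := leqP 4 b; first by rewrite (caseII_dim b4 uA u2) eqxx in u0.
have eb : b = 3%N by nlia.
case: u1 => u1; last by right; have [] := caseII_5_conclusion eb u0 uA u2 u1; split.
have n5' : n = 5%N by rewrite eb.
case: (D5_pos r0 n4 dimU E_quad E_comm E_braid TLn d0 d1 d2 n5' u0 _ u2 u1).
by rewrite -[in X in A X]n5'.
Qed.

End Invariant.
End Main.

(** * Use of the semisimplicity conditions, and uniqueness *)

Section Classification.
Variables (F : fieldType) (l r : F) (b : nat).
Hypotheses (l0 : l != 0) (r0 : r != 0) (b2 : (2 <= b)%N).
Hypothesis hr1 : forall k : nat, (1 <= k <= b.+2)%N -> r ^+ (2 * k) != 1.
Hypothesis hr2 : forall k : nat, (1 <= k <= b.+1)%N -> r ^+ (2 * k) != -1.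

(** With d = r + 1/r: d = 0 means r^2 = -1, d^2 = 1 implies r^6 = 1, and d^2 = 2 means r^4 = -1.
    These three values are excluded here and in the next two lemmas. *)
Lemma quantum2_neq0 : r + r^-1 != 0.
Proof.
have := hr2 (k := 1); rewrite muln1 => /(_ isT); apply: contra_neq => e.
have -> : r ^+ 2 = (r + r^-1) * r - 1 by field.
by rewrite e mul0r sub0r.
Qed.

Lemma quantum2_sqr_neq1 : (r + r^-1) ^+ 2 != 1.
Proof.
have k3 : (1 <= 3 <= b.+2)%N by lia.
have := hr1 k3; apply: contra_neq => e.
have -> : r ^+ (2 * 3) = ((r + r^-1) ^+ 2 - 1) * (r ^+ 2 - 1) * r ^+ 2 + 1 by field.
by rewrite e subrr !mul0r add0r.
Qed.

Lemma quantum2_sqr_neq2 : (r + r^-1) ^+ 2 != 2%:R.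
Proof.
have k2 : (1 <= 2 <= b.+1)%N by lia.
have := hr2 k2; apply: contra_neq => e.
have -> : r ^+ (2 * 2) = ((r + r^-1) ^+ 2 - 2%:R) * r ^+ 2 - 1 by field.
by rewrite e subrr !mul0r sub0r.
Qed.

Lemma irreducible_cases (W : {vspace Vn F b.+2}) :
  irreducible_invariant l r W -> \dim W = b.+2 ->
  (l = - (r / (r ^+ b) ^+ 2) /\ exists2 v, v \in W & refl_vector l r v) \/
  [/\ b = 3%N, l = r ^+ 3 & exists2 v, v \in W & two_row_vector l r v].
Proof.
move=> [Winv _ Wirr] Wdim; have [E valE] := End_exists Winv.
exact: (invariant_cases l0 r0 b2 quantum2_neq0 quantum2_sqr_neq1
  quantum2_sqr_neq2 Winv Wdim valE Wirr).
Qed.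

(** The intersection is a nonzero invariant subspace of both, hence equal to each. *)
Lemma irreducible_meet n (W W' : {vspace Vn F n}) v :
  irreducible_invariant l r W -> irreducible_invariant l r W' ->
  v \in W -> v \in W' -> v != 0 -> W = W'.
Proof.
move=> [Winv _ Wirr] [W'inv _ W'irr] vW vW' v0.
have inv : invariant_subspace l r (W :&: W')%VS.
  move=> k kn u /memv_capP[uW uW']; apply/memv_capP.
  by split; [apply: Winv|apply: W'inv].
have vI : v \in (W :&: W')%VS by apply/memv_capP.
have nz : (W :&: W')%VS <> 0%VS by move=> e; move: vI; rewrite e memv0 (negbTE v0).
have [//|<-] := Wirr _ inv (capvSl _ _).
by have [//|->] := W'irr _ inv (capvSr _ _).
Qed.

Lemma irreducible_uniq (W W' : {vspace Vn F b.+2}) : b = 3%N ->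
  irreducible_invariant l r W -> irreducible_invariant l r W' ->
  \dim W = b.+2 -> \dim W' = b.+2 -> W = W'.
Proof.
move=> eb Wi Wi' Wd Wd'.
(* Both values of l at once would give r^8 = -1, which is excluded for k = 4 = n - 1. So W and W'
   are of the same kind and share the normalised vector of that kind. *)
have excl : l = - (r / (r ^+ b) ^+ 2) -> l = r ^+ 3 -> False.
  move=> -> e; have k4 : (1 <= 4 <= b.+1)%N by lia.
  have /eqP := hr2 k4; apply; rewrite eb in e.
  have -> : r ^+ (2 * 4) = r ^+ 3 * r ^+ 5 by rewrite -exprD.
  by rewrite -e; field.
have [[e [v vW vr]]|[_ e [v vW vr]]] := irreducible_cases Wi Wd;
have [[e' [v' vW' vr']]|[_ e' [v' vW' vr']]] := irreducible_cases Wi' Wd'.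
- rewrite -(refl_vector_uniq l0 r0 b2 quantum2_neq0 vr vr') in vW'.
  apply: (irreducible_meet Wi Wi' vW vW'); exact: refl_vector_neq0 vr.
- by case: excl.
- by case: excl.
- rewrite -(two_row_vector_uniq l0 r0 b2 quantum2_neq0 vr vr') in vW'.
  apply: (irreducible_meet Wi Wi' vW vW'); exact: two_row_vector_neq0 vr.
Qed.
End Classification.

Theorem theorem5 (R : realType) (n : nat) (l r : R[i])
    (hn : (4 <= n)%N) (hl : l != 0) (hr : r != 0)
    (hr1 : forall k : nat, (1 <= k <= n)%N -> r ^+ (2 * k) != 1)
    (hr2 : forall k : nat, (1 <= k <= n - 1)%N -> r ^+ (2 * k) != -1) :
  let F : fieldType := adjoin2 l r in
  let lF : F := adjoin2_l l r in
  let rF : F := adjoin2_r l r in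
  (n <> 5%N ->
    (exists W : {vspace Vn F n},
       irreducible_invariant lF rF W /\ \dim W = n) ->
    l = - (1 / r ^+ (2 * n - 5)))
  /\
  (n = 5%N ->
    (exists W : {vspace Vn F n},
       irreducible_invariant lF rF W /\ \dim W = 5%N) ->
    (l = - (1 / r ^+ 5) \/ l = r ^+ 3)
    /\ exists! W : {vspace Vn F n},
         irreducible_invariant lF rF W /\ \dim W = 5%N).
Proof.
move=> F lF rF.
case: n hn hr1 hr2 => [//|[//|b]] hn hr1 hr2.
have b2 : (2 <= b)%N by [].
(* The hypotheses live in the complex numbers and the classification in F; they are transferred
   through the embedding [val]. *)
have vX (k : nat) : val (rF ^+ k) = r ^+ k by rewrite rmorphXn.
have hl' : lF != 0 by apply: contra_neq hl => /(congr1 val); rewrite rmorph0.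
have hr' : rF != 0 by apply: contra_neq hr => /(congr1 val); rewrite rmorph0.
have hr1' k : (1 <= k <= b.+2)%N -> rF ^+ (2 * k) != 1.
  by move=> /hr1; apply: contra_neq => /(congr1 val); rewrite vX rmorph1.
have hr2' k : (1 <= k <= b.+1)%N -> rF ^+ (2 * k) != -1.
  move=> kb; have /hr2 : (1 <= k <= b.+2 - 1)%N by rewrite subn1.
  by apply: contra_neq => /(congr1 val); rewrite vX rmorphN1.
have cases := irreducible_cases hl' hr' b2 hr1' hr2'.
(* With n = b + 2 one has 2n - 5 = 2b - 1, and r / r^(2b) = 1 / r^(2b-1). *)
have refl_l : lF = - (rF / (rF ^+ b) ^+ 2) -> l = - (1 / r ^+ (2 * b.+2 - 5)).
  move=> /(congr1 val); rewrite rmorphN rmorphM fmorphV !rmorphXn /= => ->.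
  have -> : (2 * b.+2 - 5 = (2 * b).-1)%N by lia.
  rewrite -exprM mulnC; have -> : (2 * b = (2 * b).-1.+1)%N by lia.
  by rewrite exprS /=; field; rewrite ?expf_neq0.
split=> [n5 [W [Wi Wd]]|n5 [W [Wi Wd]]].
  have [[/refl_l]//|[eb _ _]] := cases _ Wi Wd.
  by case: n5; rewrite eb.
have eb : b = 3%N by lia.
have Wd' : \dim W = b.+2 := etrans Wd (esym n5).
split.
  have [[/refl_l-> _]|[_ e _]] := cases _ Wi Wd'; first by left; rewrite eb.
  by right; rewrite -vX -e.
exists W; split=> // W' [Wi' Wd''].
exact: (irreducible_uniq hl' hr' b2 hr1' hr2' eb Wi Wi' Wd' (etrans Wd'' (esym n5))).
Qed.
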